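(* Let $n\ge 1$, let $f,g,u,v\in\mathrm{Sym}(\mathbb{C}^n)\cap H(\mathbb{C}^n)$, and write $\varphi=f+\overline{g}$ and $\psi=u+\overline{v}$. If $T_\varphi T_\psi=0$ on the Fock space $F^2$, then $\varphi=0$ or $\psi=0$.
   Context: $dV$ is Lebesgue measure on $\mathbb{C}^n$ and $d\mu(z)=\pi^{-n}e^{-|z|^2}dV(z)$. For $z,w\in\mathbb{C}^n$, $z\cdot w=\sum_k z_kw_k$ (bilinear) and $|z|^2=z\cdot\overline{z}$. $H(\mathbb{C}^n)$ is the space of entire functions and $F^2=L^2(\mathbb{C}^n,d\mu)\cap H(\mathbb{C}^n)$ is the Fock space, with reproducing kernel $K_z(w)=e^{w\cdot\overline{z}}$. $\mathrm{Sym}(\mathbb{C}^n)$ is the set of complex measurable functions $u$ such that for every $c>0$ the function $u(z)e^{-c|z|^2}$ is essentially bounded. Toeplitz operators: $T_\varphi=PM_\varphi$, where $M_\varphi$ is multiplication by $\varphi$ and $P$ is the orthogonal projection of $L^2(\mathbb{C}^n,d\mu)$ onto $F^2$; explicitly $T_\varphi F(z)=\int_{\mathbb{C}^n}\varphi(w)F(w)e^{z\cdot\overline{w}}\,d\mu(w)$. Such operators may be unbounded; identities between Toeplitz operators and their products are understood as identities on the (dense) linear span of the kernels $K_z$, $z\in\mathbb{C}^n$, where all the integrals involved converge. *)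

(* Defs.v *)
From HB Require Import structures.
From mathcomp Require Import all_boot all_order all_algebra.
From mathcomp Require Import complex.
From mathcomp Require Import all_classical all_reals all_analysis.

Set Implicit Arguments.
Unset Strict Implicit.
Unset Printing Implicit Defensive.

Import Order.TTheory GRing.Theory Num.Theory.
Import numFieldNormedType.Exports.

Local Open Scope classical_set_scope.
Local Open Scope ring_scope.
Local Open Scope complex_scope.

(* The product of two sigma-finite measures is sigma-finite; the library's
   canonical instance for this is shadowed by the one for subprobabilities. *)
Section sigma_finite_prod.
Context d1 d2 (T1 : measurableType d1) (T2 : measurableType d2) (R : realType).
Variable m1 : {sigma_finite_measure set T1 -> \bar R}.
Variable m2 : {sigma_finite_measure set T2 -> \bar R}.

Definition sigma_finite_prod : set (T1 * T2) -> \bar R := (m1 \x m2)%E.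

HB.instance Definition _ := Measure.on sigma_finite_prod.

Let sigma_finite_prodP : sigma_finite setT sigma_finite_prod.
Proof.
have /sigma_finiteP[F [TF ndF Foo]] := sigma_finiteT m1.
have /sigma_finiteP[G [TG ndG Goo]] := sigma_finiteT m2.
exists (fun n => F n `*` G n).
  rewrite -setXTT TF TG predeqE => -[x y]; split.
    move=> [/= [n _ Fnx] [k _ Gky]]; exists (maxn n k) => //; split.
    - by move: x Fnx; exact/subsetPset/ndF/leq_maxl.
    - by move: y Gky; exact/subsetPset/ndG/leq_maxr.
  by move=> [n _ []/= ? ?]; split; exists n.
move=> k; have [? ?] := Foo k; have [? ?] := Goo k.
split; first exact: measurableX.
rewrite /sigma_finite_prod product_measure1E//.
by rewrite lte_mul_pinfty// ge0_fin_numE.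
Qed.

HB.instance Definition _ := Measure_isSigmaFinite.Build _ _ _ sigma_finite_prod
  sigma_finite_prodP.

End sigma_finite_prod.

(* The n-fold product [tuple_measure n] of a sigma-finite measure [m]. *)
Section tuple_measure.
Context d (T : measurableType d) (R : realType).

Definition cons_pt n (p : T * n.-tuple T) : n.+1.-tuple T :=
  [tuple of p.1 :: p.2].

Definition uncons_pt n (t : n.+1.-tuple T) : T * n.-tuple T :=
  (tnth t ord0, [tuple of behead t]).

Lemma cons_ptK n : cancel (@cons_pt n) (@uncons_pt n).
Proof. by case=> p t; congr pair; apply/val_inj. Qed.

Lemma uncons_ptK n : cancel (@uncons_pt n) (@cons_pt n).
Proof. by move=> t; rewrite [RHS]tuple_eta. Qed.

Lemma measurable_cons_pt n : measurable_fun setT (@cons_pt n).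
Proof. exact: measurable_cons. Qed.

Lemma measurable_uncons_pt n : measurable_fun setT (@uncons_pt n).
Proof.
apply/measurable_fun_pairP; split => /=.
- exact: measurable_tnth.
- exact: measurable_behead.
Qed.

Variable m : {sigma_finite_measure set T -> \bar R}.

Section cons_measure.
Context n (mn : {sigma_finite_measure set (n.-tuple T) -> \bar R}).

Definition cons_measure : set (n.+1.-tuple T) -> \bar R :=
  pushforward (sigma_finite_prod m mn) (@cons_pt n).

Let push : {measure set (n.+1.-tuple T) -> \bar R} :=
  measure_function_pushforward__canonical__measure_function_Measure
    (sigma_finite_prod m mn) (@measurable_cons_pt n).

Let cons_measure0 : cons_measure set0 = 0%E.
Proof. exact: (measure0 push). Qed.

Let cons_measure_ge0 A : (0 <= cons_measure A)%E.
Proof. exact: (measure_ge0 push). Qed.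

Let cons_measure_sigma_additive : semi_sigma_additive cons_measure.
Proof. exact: (@measure_semi_sigma_additive _ _ _ push). Qed.

HB.instance Definition _ := isMeasure.Build _ _ _ cons_measure
  cons_measure0 cons_measure_ge0 cons_measure_sigma_additive.

Let cons_measure_sigma_finite : sigma_finite setT cons_measure.
Proof.
have [F FT mF] := sigma_finiteT (sigma_finite_prod m mn).
exists (fun k => @uncons_pt n @^-1` F k).
  by rewrite -preimage_bigcup -FT preimage_setT.
move=> k; have [mFk Fkoo] := mF k; split.
  by rewrite -[X in measurable X]setTI; exact: measurable_uncons_pt.
rewrite /cons_measure /pushforward -comp_preimage.
by rewrite (_ : _ \o _ = id)//; apply/funext => p /=; exact: cons_ptK.
Qed.

HB.instance Definition _ := Measure_isSigmaFinite.Build _ _ _ cons_measure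
  cons_measure_sigma_finite.

End cons_measure.

Fixpoint tuple_measure n : {sigma_finite_measure set (n.-tuple T) -> \bar R} :=
  match n with
  | 0 => \d_ [tuple]
  | n'.+1 => cons_measure (tuple_measure n')
  end.

End tuple_measure.

(* Only the topology of C over itself is put on R[i]; as a module, R[i] is
   already a space over R, so C as a one-dimensional complex space is written
   [R[i]^o]. *)
HB.instance Definition _ (R : realType) := PseudoPointedMetric.copy R[i] R[i]^o.

(* C^n is ['rV[R[i]]_n], whose coordinates are [z 0 k]. It carries the product
   sigma-algebra and the Lebesgue measure of (R^2)^n, transported along the
   bijection [cvec]. *)
Section complex_space.
Context (R : realType) (n : nat).
Local Notation RR := (measurableTypeR R * measurableTypeR R)%type.

Definition cvec (t : n.-tuple RR) : 'rV[R[i]]_n :=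
  \row_k ((tnth t k).1 +i* (tnth t k).2).

Definition cvec_measurable : set (set 'rV[R[i]]_n) :=
  [set A | measurable (cvec @^-1` A)].

Let cvec_measurable0 : cvec_measurable set0.
Proof. by rewrite /cvec_measurable/= preimage_set0. Qed.

Let cvec_measurableC A : cvec_measurable A -> cvec_measurable (~` A).
Proof. by rewrite /cvec_measurable/= preimage_setC; exact: measurableC. Qed.

Let cvec_measurable_bigcup (F : (set 'rV[R[i]]_n)^nat) :
  (forall i, cvec_measurable (F i)) -> cvec_measurable (\bigcup_i (F i)).
Proof.
move=> mF; rewrite /cvec_measurable/= preimage_bigcup.
exact: bigcupT_measurable.
Qed.

HB.instance Definition _ := @isMeasurable.Build default_measure_display
  'rV[R[i]]_n cvec_measurable
  cvec_measurable0 cvec_measurableC cvec_measurable_bigcup.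

Lemma measurable_cvec : measurable_fun setT cvec.
Proof. by move=> _ A mA; rewrite setTI. Qed.

Definition lebesgue_Cn : {measure set 'rV[R[i]]_n -> \bar R} :=
  measure_function_pushforward__canonical__measure_function_Measure
    (tuple_measure (sigma_finite_prod (@lebesgue_measure R)
                                      (@lebesgue_measure R)) n)
    measurable_cvec.

Lemma lebesgue_CnE A : lebesgue_Cn A =
  tuple_measure (sigma_finite_prod (@lebesgue_measure R)
                                   (@lebesgue_measure R)) n (cvec @^-1` A).
Proof. by []. Qed.

End complex_space.

Section fock.
Context (R : realType).
Local Notation C := R[i].

Definition cexp (z : C) : C :=
  (expR (complex.Re z) * cos (complex.Im z)) +i*
  (expR (complex.Re z) * sin (complex.Im z)).

Variable n : nat.
Local Notation Cn := 'rV[C]_n.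
Implicit Types (z w : Cn) (f u phi F : Cn -> C).

Definition cdot z w : C := \sum_(k < n) z 0 k * w 0 k.

Definition cconj z : Cn := map_mx conjc z.

Definition norm2 z : R := complex.Re (cdot z (cconj z)).

(* Frechet differentiability over the complex scalars. *)
Definition entire f : Prop := forall z, differentiable (f : Cn -> C^o) z.

Definition measurable_cfun f : Prop :=
  measurable_fun setT (fun z => complex.Re (f z)) /\
  measurable_fun setT (fun z => complex.Im (f z)).

Definition ess_bounded f : Prop :=
  exists M : R, {ae lebesgue_Cn R n, forall z, `|f z| <= M%:C}.

Definition Sym u : Prop :=
  measurable_cfun u /\
  forall c : R, 0 < c -> ess_bounded (fun z => u z * (expR (- c * norm2 z))%:C).

Definition Cintegral F : C :=
  (\int[lebesgue_Cn R n]_z complex.Re (F z)) +i*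
  (\int[lebesgue_Cn R n]_z complex.Im (F z)).

Definition gauss_density z : R := pi ^- n * expR (- norm2 z).

(* The integral against dmu = pi^-n exp(-|z|^2) dV. *)
Definition gauss_integral F : C :=
  Cintegral (fun w => F w * (gauss_density w)%:C).

(* The reproducing kernel K_z of the Fock space. *)
Definition fock_kernel z w : C := cexp (cdot w (cconj z)).

Definition kernel_span F : Prop :=
  exists (m : nat) (a : 'I_m -> C) (z : 'I_m -> Cn),
    F = fun w => \sum_(j < m) a j * fock_kernel (z j) w.

(* T_phi = P M_phi, with the orthogonal projection P onto the Fock space written
   as integration against the reproducing kernel. *)
Definition toeplitz phi F z : C :=
  gauss_integral (fun w => phi w * F w * cexp (cdot z (cconj w))).

(* T_phi T_psi = 0: Toeplitz operators may be unbounded, and identities between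
   them are identities on the dense span of the kernels. *)
Definition toeplitz_prod_eq0 phi psi : Prop :=
  forall F, kernel_span F -> forall z, toeplitz phi (toeplitz psi F) z = 0.

End fock.

(* Main.v *)
(* Applying T_phi T_psi to the kernel K_a and using the reproducing property gives,
   for all z, a and l,
     f(z) u(z) + f(z) conj v(a) + conj (g v)(a)
       + int u(z + x) e^(- l.x) conj g(a + conj l + x) dmu(x) = 0.
   If u is not constant, take for z a near-maximum of |u| e^(-c|.|^2), where
   l = conj (2 c z). Since u has order 2 and type 0, the function
   x |-> u(z + x) e^(- l.x) / u(z) is bounded by 2 e^(c|x|^2) and equals 1 at 0, hence
   tends to 1 as c -> 0 by Schwarz's lemma. With a = b - conj l, dividing the identity
   by u(z) gives f(z) + conj g(b) -> 0 for every b, so that g is constant. When u or g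
   is constant, the integral is u(z) conj g(a), the identity reads
   (f(z) + conj g(a)) (u(z) + conj v(a)) = 0, and the identity theorem concludes.
   Differentiability is only assumed pointwise, whence a Goursat argument. *)
Require Import Defs.
From HB Require Import structures.
From mathcomp Require Import all_boot all_order all_algebra.
From mathcomp Require Import complex.
From mathcomp Require Import ring lra.
From mathcomp Require Import all_classical all_reals all_analysis.
From mathcomp Require Import measurable_realfun.
Set Implicit Arguments.
Unset Strict Implicit.
Unset Printing Implicit Defensive.
Import Order.TTheory GRing.Theory Num.Theory.
Import numFieldNormedType.Exports.
Local Open Scope classical_set_scope.
Local Open Scope ring_scope.
Local Open Scope complex_scope.

(** Why the terms with [v] and [g v] disappear: at a = b - conj l they grow at most like e^(|l|^2/4)
    = e^(c^2 |z|^2), hence like e^(c |z|^2) when c <= 1. At the peak, for small c, |u(z)| exceeds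
    any prescribed multiple of e^(c |z|^2), because a nonconstant [u] is unbounded by Liouville's
    theorem. The quotients are therefore small although nothing is known about the position of z.
    The value f(z) is not controlled either and comes with a factor close to 1; it is eliminated by
    writing the relation at one and the same peak for two points b and b'. The freedom in l comes
    from Fubini's theorem: a double integral against e^(w . conj x) is evaluated in both orders by
    the reproducing property, and l enters the two results differently. Holomorphy is exploited
    along complex lines. There the Liouville, Schwarz and identity theorems all follow from the mean
    value property on circles, and Gaussian integrals are computed one coordinate at a time. *)

Section modulus.
Context {R : realType}.
Local Notation C := R[i].
Implicit Types (z w : C) (x y : R).

(** The norm of [R[i]] takes its values in [R[i]]; a modulus with values in [R] gives access to real
    inequalities and to [lra]. *)
Definition cabs z : R := complex.Re `|z|.

Lemma normCE z : `|z| = (cabs z)%:C.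
Proof. by rewrite /cabs normc_def. Qed.

Lemma cabsE z : cabs z = Num.sqrt (complex.Re z ^+ 2 + complex.Im z ^+ 2).
Proof. by rewrite /cabs normc_def. Qed.

Lemma cabs_ge0 z : 0 <= cabs z.
Proof. by rewrite cabsE sqrtr_ge0. Qed.

Lemma cabs0 : cabs 0 = 0.
Proof. by rewrite /cabs normr0. Qed.

Lemma cabs1 : cabs 1 = 1.
Proof. by rewrite /cabs normr1. Qed.

Lemma cabsM z w : cabs (z * w) = cabs z * cabs w.
Proof. by apply: complexI; rewrite rmorphM/= -!normCE normrM. Qed.

Lemma cabsN z : cabs (- z) = cabs z.
Proof. by rewrite /cabs normrN. Qed.

Lemma cabsD z w : cabs (z + w) <= cabs z + cabs w.
Proof. by rewrite -lecR rmorphD/= -!normCE ler_normD. Qed.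

Lemma cabsB z w : cabs (z - w) <= cabs z + cabs w.
Proof. by rewrite (le_trans (cabsD _ _))// cabsN. Qed.

Lemma cabsV z : cabs z^-1 = (cabs z)^-1.
Proof. by apply: complexI; rewrite fmorphV/= -!normCE normfV. Qed.

Lemma cabsX z n : cabs (z ^+ n) = cabs z ^+ n.
Proof. by apply: complexI; rewrite rmorphXn/= -!normCE normrX. Qed.

Lemma cabs_eq0 z : (cabs z == 0) = (z == 0).
Proof.
by rewrite -(inj_eq (@complexI R)) -normCE [(0 : R)%:C](_ : _ = 0)// normr_eq0.
Qed.

Lemma cabs_gt0 z : (0 < cabs z) = (z != 0).
Proof. by rewrite lt_neqAle cabs_ge0 andbT eq_sym cabs_eq0. Qed.

Lemma cabs_real x : cabs x%:C = `|x|.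
Proof. by rewrite cabsE/= expr0n addr0 sqrtr_sqr. Qed.

Lemma cabs_conj z : cabs (conjc z) = cabs z.
Proof. by case: z => a b; rewrite !cabsE/= sqrrN. Qed.

Lemma cabs_Re z : `|complex.Re z| <= cabs z.
Proof.
by rewrite cabsE -[leLHS]sqrtr_sqr ler_sqrt ?lerDl ?addr_ge0 ?sqr_ge0.
Qed.

Lemma cabs_Im z : `|complex.Im z| <= cabs z.
Proof.
by rewrite cabsE -[leLHS]sqrtr_sqr ler_sqrt ?lerDr ?addr_ge0 ?sqr_ge0.
Qed.

Lemma cabs_le_ReIm z : cabs z <= `|complex.Re z| + `|complex.Im z|.
Proof.
case: z => a b /=; have -> : a +i* b = a%:C + b%:C * 'i.
  by apply/eqP; rewrite eq_complex/= !(mulr0, mul0r, mulr1, subr0, addr0, add0r) !eqxx.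
rewrite (le_trans (cabsD _ _))// cabsM !cabs_real (_ : cabs 'i = 1) ?mulr1//.
by rewrite cabsE/= expr0n add0r expr1n sqrtr1.
Qed.

Lemma cabs_sqr z : cabs z ^+ 2 = complex.Re z ^+ 2 + complex.Im z ^+ 2.
Proof. by rewrite cabsE sqr_sqrtr// addr_ge0// sqr_ge0. Qed.

Lemma cabs_le0 z : cabs z <= 0 -> z = 0.
Proof. by move=> h; apply/eqP; rewrite -cabs_eq0 eq_le h cabs_ge0. Qed.

Lemma cabs_arb z : (forall e, 0 < e -> cabs z <= e) -> z = 0.
Proof.
by move=> h; apply: cabs_le0; apply/ler_addgt0Pr => e e0; rewrite add0r h.
Qed.

Lemma Re_real_mul x z : complex.Re (x%:C * z) = x * complex.Re z.
Proof. by case: z => a b /=; rewrite mul0r subr0. Qed.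

End modulus.

(** * The complex exponential *)

Section cexp_theory.
Context {R : realType}.
Local Notation C := R[i].
Implicit Types (z w : C).

Lemma cexpD z w : cexp (z + w) = cexp z * cexp w.
Proof.
case: z w => [a b] [c d]; rewrite /cexp/= expRD cosD sinD; simpc.
by congr (_ +i* _); ring.
Qed.

Lemma cexp0 : cexp (0 : C) = 1.
Proof. by rewrite /cexp/= expR0 cos0 sin0 mulr1 mulr0. Qed.

Lemma cabs_cexp z : cabs (cexp z) = expR (complex.Re z).
Proof.
by rewrite cabsE/= !exprMn -mulrDr cos2Dsin2 mulr1 sqrtr_sqr ger0_norm ?expR_ge0.
Qed.

Lemma cexp_neq0 z : cexp z != 0.
Proof. by rewrite -cabs_gt0 cabs_cexp expR_gt0. Qed.

Lemma cexpN z : cexp (- z) = (cexp z)^-1.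
Proof.
by apply: (mulIf (cexp_neq0 z)); rewrite -cexpD addNr cexp0 mulVf// cexp_neq0.
Qed.

Lemma cexp_conj z : conjc (cexp z) = cexp (conjc z).
Proof. by case: z => a b; rewrite /cexp/= cosN sinN mulrN. Qed.

Lemma cexpD2pii z : cexp (z + 0 +i* (pi *+ 2)) = cexp z.
Proof. by rewrite cexpD {2}/cexp/= expR0 cos2pi sin2pi mulr1 mulr0 mulr1. Qed.

Lemma is_derive_expand (f : R -> R) (x df : R) : is_derive x 1 f df ->
  forall e, 0 < e -> exists2 d, 0 < d & forall h, `|h| < d ->
    `|f (x + h) - f x - df * h| <= e * `|h|.
Proof.
move=> [fd dfE] e e0.
have : h^-1 *: (f (h *: 1 + x) - f x) @[h --> 0^'] --> df by rewrite -dfE; exact: fd.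
move=> /cvgrPdist_le /(_ _ e0) [d /= d0 hd].
exists d => // h hlt.
have [->|h0] := eqVneq h 0; first by rewrite addr0 subrr mulr0 subr0 normr0 mulr0.
have := hd h; rewrite /= sub0r normrN => /(_ hlt h0).
rewrite /GRing.scale/= mulr1 => H.
have -> : f (x + h) - f x - df * h = - (df - h^-1 * (f (h + x) - f x)) * h.
  by rewrite addrC [h + x]addrC; field.
by rewrite normrM normrN ler_wpM2r.
Qed.

Lemma cexp_expand e : 0 < e -> exists2 d, 0 < d & forall w : C, cabs w < d ->
  cabs (cexp w - 1 - w) <= e * cabs w.
Proof.
move=> e0; have e8 : 0 < Num.min (e / 8) 1 by rewrite lt_min divr_gt0//= ltr01.
have [d1 d10 h1] := is_derive_expand (is_derive_expR (0 : R)) e8.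
have [d2 d20 h2] := is_derive_expand (is_derive_cos (0 : R)) e8.
have [d3 d30 h3] := is_derive_expand (is_derive_sin (0 : R)) e8.
set e' := Num.min (e / 8) 1 in e8 h1 h2 h3.
have e'e : e' <= e / 8 by rewrite /e' ge_min lexx.
have e'1 : e' <= 1 by rewrite /e' ge_min lexx orbT.
(* The four error terms get the shares e/8, 3e/8, 3e/8 and e/8. The radius 1 ensures [expR x] <= 3,
   and e/16 makes the quadratic term (exp x - 1) y small. *)
exists (Num.min (Num.min d1 (Num.min d2 d3)) (Num.min 1 (e / 16))).
  by rewrite !lt_min d10 d20 d30 ltr01 divr_gt0.
move=> [x y]; rewrite !lt_min => /andP[/andP[w1 /andP[w2 w3]] /andP[w4 w5]].
set r := cabs _ in w1 w2 w3 w4 w5 *.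
have xr : `|x| <= r := cabs_Re (x +i* y).
have yr : `|y| <= r := cabs_Im (x +i* y).
have := h1 x (le_lt_trans xr w1); rewrite add0r expR0 mul1r => H1.
have := h2 y (le_lt_trans yr w2); rewrite add0r cos0 sin0 oppr0 mul0r subr0 => H2.
have := h3 y (le_lt_trans yr w3); rewrite add0r cos0 sin0 subr0 mul1r => H3.
rewrite (le_trans (cabs_le_ReIm _))// /cexp/=.
have Ex : expR x <= 3.
  move: H1; rewrite ler_norml => /andP[_]; have := ler_norm x.
  have := normr_ge0 x; nra.
have E0 := expR_ge0 x.
have -> : expR x * cos y - 1 - x = (expR x - 1 - x) + expR x * (cos y - 1) by ring.
have -> : expR x * sin y - 0 - y = expR x * (sin y - y) + (expR x - 1) * y by ring.
have Ex1 : `|expR x - 1| <= 2 * r.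
  have -> : expR x - 1 = (expR x - 1 - x) + x by ring.
  rewrite (le_trans (ler_normD _ _))//; have := normr_ge0 x; nra.
have A1 := ler_normD (expR x - 1 - x) (expR x * (cos y - 1)).
have A2 := ler_normD (expR x * (sin y - y)) ((expR x - 1) * y).
rewrite !normrM (ger0_norm E0) in A1 A2.
have r0 : 0 <= r by exact: cabs_ge0.
have B1 : e' * `|x| <= e / 8 * r by apply: ler_pM => //; exact: ltW.
have B2 : e' * `|y| <= e / 8 * r by apply: ler_pM => //; exact: ltW.
have B3 : expR x * `|cos y - 1| <= 3 * (e / 8 * r).
  by apply: ler_pM => //; exact: le_trans B2.
have B4 : expR x * `|sin y - y| <= 3 * (e / 8 * r).
  by apply: ler_pM => //; exact: le_trans B2.
have B5 : `|expR x - 1| * `|y| <= 2 * r * (e / 16).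
  by apply: ler_pM => //; exact: le_trans yr (ltW w5).
by lra.
Qed.

End cexp_theory.

(** * Complex differentiability in one variable *)

Section cdiff.
Context {R : realType}.
Local Notation C := R[i].
Implicit Types (z w : C) (f g h q : C -> C).

Definition cont0 q := forall e, 0 < e -> exists2 d, 0 < d &
  forall w, cabs w < d -> cabs (q w - q 0) <= e.

(* Caratheodory's formulation of complex differentiability. *)
Definition cdiff f z := exists2 q, cont0 q & forall w, f (z + w) = f z + w * q w.

Lemma cont0_cst z : cont0 (fun=> z).
Proof. by move=> e e0; exists 1 => // w _; rewrite subrr cabs0 ltW. Qed.

Lemma cont0_id : cont0 id.
Proof. by move=> e e0; exists e => // w; rewrite subr0 => /ltW. Qed.

Lemma cont0D f g : cont0 f -> cont0 g -> cont0 (fun w => f w + g w).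
Proof.
move=> cf cg e e0; have e20 : 0 < e / 2 by rewrite divr_gt0.
have [d1 d10 h1] := cf _ e20; have [d2 d20 h2] := cg _ e20.
exists (Num.min d1 d2); first by rewrite lt_min d10.
move=> w; rewrite lt_min => /andP[w1 w2].
have -> : f w + g w - (f 0 + g 0) = (f w - f 0) + (g w - g 0) by ring.
by rewrite (le_trans (cabsD _ _))// [e]splitr lerD ?h1 ?h2.
Qed.

Lemma cont0M f g : cont0 f -> cont0 g -> cont0 (fun w => f w * g w).
Proof.
move=> cf cg e e0.
(* If both increments a and b are at most min(e/(2K), 1), then ab <= a and the error is at most a
   (|g 0| + 1) + b |f 0| <= e/2. *)
pose K := cabs (f 0) + cabs (g 0) + 1.
have K0 : 0 < K by rewrite ltr_wpDl// addr_ge0// cabs_ge0.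
have e1 : 0 < Num.min (e / (2 * K)) 1 by rewrite lt_min ltr01 divr_gt0// mulr_gt0.
have [d1 d10 h1] := cf _ e1; have [d2 d20 h2] := cg _ e1.
exists (Num.min d1 d2); first by rewrite lt_min d10.
move=> w; rewrite lt_min => /andP[w1 w2].
have := h1 _ w1; rewrite le_min => /andP[F1 F2].
have := h2 _ w2; rewrite le_min => /andP[G1 G2].
have -> : f w * g w - f 0 * g 0 =
  (f w - f 0) * (g w - g 0) + (f w - f 0) * g 0 + f 0 * (g w - g 0) by ring.
rewrite (le_trans (cabsD _ _))//.
have := cabsD ((f w - f 0) * (g w - g 0)) ((f w - f 0) * g 0).
rewrite !cabsM => H1.
set a := cabs (f w - f 0) in F1 F2 H1 *; set b := cabs (g w - g 0) in G1 G2 H1 *.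
have a0 : 0 <= a by exact: cabs_ge0.
have b0 : 0 <= b by exact: cabs_ge0.
have f0 := cabs_ge0 (f 0); have g0 := cabs_ge0 (g 0).
have ab : a * b <= a by rewrite ler_piMr.
have E : e / (2 * K) * K = e / 2 by field; exact: lt0r_neq0.
have A : a * (cabs (g 0) + 1) <= e / (2 * K) * (cabs (g 0) + 1) by rewrite ler_pM//;
  lra.
have B : b * cabs (f 0) <= e / (2 * K) * cabs (f 0) by rewrite ler_pM//; lra.
have E1 : e / (2 * K) * K =
  e / (2 * K) * (cabs (g 0) + 1) + e / (2 * K) * cabs (f 0) by rewrite /K; ring.
by lra.
Qed.

Lemma cont0_comp f q : cont0 f -> cont0 q -> q 0 = 0 -> cont0 (f \o q).
Proof.
move=> cf cq q0 e e0; have [d1 d10 h1] := cf _ e0.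
have d120 : 0 < d1 / 2 by rewrite divr_gt0.
have [d d0 h] := cq _ d120; exists d => // w wd /=; rewrite q0.
apply: h1; have := h _ wd; rewrite q0 subr0 => /le_lt_trans; apply.
by lra.
Qed.

Lemma cdiff_expand f z : (exists L, forall e, 0 < e -> exists2 d, 0 < d &
  forall w, cabs w < d -> cabs (f (z + w) - f z - L * w) <= e * cabs w) ->
  cdiff f z.
Proof.
move=> [L hL]; exists (fun w => if w == 0 then L else (f (z + w) - f z) / w).
  move=> e e0; have [d d0 h] := hL _ e0; exists d => // w wd.
  rewrite eqxx; case: eqP => [_|/eqP w0]; first by rewrite subrr cabs0 ltW.
  have wg0 : 0 < cabs w by rewrite cabs_gt0.
  rewrite -(ler_pM2r wg0) -cabsM.
  have -> : ((f (z + w) - f z) / w - L) * w = f (z + w) - f z - L * w by field.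
  exact: h.
move=> w; case: eqP => [->|/eqP w0]; first by rewrite addr0 mul0r addr0.
by rewrite mulrC divfK//; ring.
Qed.

Lemma cdiff_expandP f z : cdiff f z -> exists L, forall e, 0 < e ->
  exists2 d, 0 < d & forall w, cabs w < d ->
  cabs (f (z + w) - f z - L * w) <= e * cabs w.
Proof.
move=> [q cq hq]; exists (q 0) => e e0; have [d d0 h] := cq _ e0.
exists d => // w wd; rewrite hq.
have -> : f z + w * q w - f z - q 0 * w = (q w - q 0) * w by ring.
by rewrite cabsM ler_wpM2r ?cabs_ge0 ?h.
Qed.

Lemma cdiff_near f g z d : 0 < d -> (forall w, cabs w < d -> f (z + w) = g (z + w)) ->
  cdiff g z -> cdiff f z.
Proof.
move=> d0 fg /cdiff_expandP[L hL]; apply: cdiff_expand; exists L => e e0.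
have [d' d'0 h] := hL _ e0; exists (Num.min d d'); first by rewrite lt_min d0.
move=> w; rewrite lt_min => /andP[wd wd'].
have fz : f z = g z by rewrite -[z]addr0 fg// cabs0.
by rewrite fg// fz h.
Qed.

Lemma cdiff_cont f z : cdiff f z -> cont0 (fun w => f (z + w)).
Proof.
move=> [q cq hq] e e0.
have [d d0 h] := cont0M cont0_id cq e0; exists d => // w /h; rewrite !hq.
by have -> : f z + w * q w - (f z + 0 * q 0) = w * q w - 0 * q 0 by ring.
Qed.

Lemma cdiff_cst (c : C) z : cdiff (fun=> c) z.
Proof. by exists (fun=> 0); [exact: cont0_cst|move=> w; rewrite mulr0 addr0]. Qed.

Lemma cdiff_id z : cdiff id z.
Proof. by exists (fun=> 1); [exact: cont0_cst|move=> w; rewrite mulr1]. Qed.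

Lemma cdiffD f g z : cdiff f z -> cdiff g z -> cdiff (fun w => f w + g w) z.
Proof.
move=> [p cp hp] [q cq hq]; exists (fun w => p w + q w); first exact: cont0D.
by move=> w; rewrite hp hq; ring.
Qed.

Lemma cdiffM f g z : cdiff f z -> cdiff g z -> cdiff (fun w => f w * g w) z.
Proof.
move=> [p cp hp] [q cq hq].
exists (fun w => (fun=> f z) w * q w + (p w * (fun=> g z) w + w * (p w * q w))).
  apply: cont0D; first by apply: cont0M => //; exact: cont0_cst.
  apply: cont0D; first by apply: cont0M => //; exact: cont0_cst.
  by apply: cont0M; [exact: cont0_id|exact: cont0M].
by move=> w; rewrite hp hq; ring.
Qed.

Lemma cdiffX f z n : cdiff f z -> cdiff (fun w => f w ^+ n) z.
Proof.
move=> fz; elim: n => [|n IH].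
  by under [X in cdiff X _]funext do rewrite expr0; exact: cdiff_cst.
by under [X in cdiff X _]funext do rewrite exprS; exact: cdiffM.
Qed.

(** In Caratheodory's form the chain rule is a substitution: the slope of the composite is q(w) p(w
    q(w)), with no division by an increment that may vanish. *)
Lemma cdiff_comp f g z : cdiff g z -> cdiff f (g z) -> cdiff (f \o g) z.
Proof.
move=> [q cq hq] [p cp hp]; exists (fun w => q w * (p \o (fun w => w * q w)) w).
  apply: cont0M => //; apply: cont0_comp => //; last by rewrite mul0r.
  by apply: cont0M => //; exact: cont0_id.
by move=> w /=; rewrite hq hp; ring.
Qed.

Lemma cdiff_cexp z : cdiff (@cexp R) z.
Proof.
apply: cdiff_expand; exists (cexp z) => e e0.
have z0 : 0 < cabs (cexp z) by rewrite cabs_gt0 cexp_neq0.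
have [d d0 h] := cexp_expand (divr_gt0 e0 z0); exists d => // w /h H.
rewrite cexpD; have -> : cexp z * cexp w - cexp z - cexp z * w =
  cexp z * (cexp w - 1 - w) by ring.
by rewrite cabsM mulrC -ler_pdivlMr// mulrAC.
Qed.

Lemma cdiffV z : z != 0 -> cdiff (fun w => w^-1) z.
Proof.
move=> z0; apply: cdiff_expand; exists (- z^-1 ^+ 2) => e e0.
have zg0 : 0 < cabs z by rewrite cabs_gt0.
(* The first bound keeps |z + w| >= |z|/2; the remainder w^2 / (z^2 (z + w)) is then at most 2 |w|^2
   / |z|^3, which the second bound turns into e |w|. *)
exists (Num.min (cabs z / 2) (e * cabs z ^+ 3 / 2)).
  by rewrite lt_min !divr_gt0// mulr_gt0// exprn_gt0.
move=> w; rewrite lt_min => /andP[w1 w2].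
have zw : cabs z / 2 <= cabs (z + w).
  have := cabsB (z + w) w; rewrite addrK; lra.
have zw0 : z + w != 0 by rewrite -cabs_gt0; lra.
have -> : (z + w)^-1 - z^-1 - - z^-1 ^+ 2 * w = w * (z^-1 ^+ 2 * (z + w)^-1) * w.
  by field; rewrite zw0 z0.
rewrite cabsM ler_wpM2r ?cabs_ge0//.
rewrite [cabs (_ * (_ * _))]cabsM [cabs (_ * _)]cabsM cabsX !cabsV exprVn mulrA
  ler_pdivrMr; last by lra.
rewrite ler_pdivrMr ?exprn_gt0//.
have : e * (cabs z / 2) * cabs z ^+ 2 <= e * cabs (z + w) * cabs z ^+ 2.
  by rewrite ler_wpM2r ?sqr_ge0// ler_wpM2l// ltW.
have -> : e * (cabs z / 2) * cabs z ^+ 2 = e * cabs z ^+ 3 / 2 by field.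
by lra.
Qed.

End cdiff.

(** * Goursat's theorem and its consequences in one variable *)
Section dyadic_average.
Context {R : realType}.
Local Notation C := R[i].
Implicit Types (F G : R -> C).

(* Averages over the dyadic points of [0, 1]: they replace contour integrals, as
   bisecting the contour then commutes exactly with averaging. *)
Fixpoint dyavg N G : C := if N is N'.+1 then
  (dyavg N' (fun t => G (t / 2)) + dyavg N' (fun t => G ((1 + t) / 2))) / 2 else G 0.

Lemma eq_dyavg N F G : (forall t, 0 <= t <= 1 -> F t = G t) -> dyavg N F = dyavg N G.
Proof.
elim: N F G => [|N IH] F G FG /=; first by rewrite FG// lexx ler01.
by congr ((_ + _) / 2); apply: IH => t /andP[t0 t1]; apply: FG; apply/andP; split; lra.
Qed.

Lemma dyavg_lin N (a b : C) F G :
  dyavg N (fun t => a * F t + b * G t) = a * dyavg N F + b * dyavg N G.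
Proof. by elim: N F G => [//|N IH] F G /=; rewrite !IH; field. Qed.

Lemma dyavgD N F G : dyavg N (fun t => F t + G t) = dyavg N F + dyavg N G.
Proof.
rewrite -[dyavg N F]mul1r -[dyavg N G]mul1r -dyavg_lin.
by apply: eq_dyavg => t _; rewrite !mul1r.
Qed.

Lemma dyavg_cst N (c : C) : dyavg N (fun=> c) = c.
Proof. by elim: N => [//|N IH] /=; rewrite IH; field. Qed.

Lemma dyavgZ N (a : C) F : dyavg N (fun t => a * F t) = a * dyavg N F.
Proof. by elim: N F => [//|N IH] F /=; rewrite !IH; field. Qed.

Lemma dyavg_le N G M : (forall t, 0 <= t <= 1 -> cabs (G t) <= M) ->
  cabs (dyavg N G) <= M.
Proof.
elim: N G => [|N IH] G GM /=; first by rewrite GM// lexx ler01.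
rewrite cabsM cabsV (_ : cabs 2 = 2); last first.
  by rewrite -[2](rmorph_nat (real_complex R) 2) cabs_real ger0_norm.
rewrite ler_pdivrMr// (le_trans (cabsD _ _))// [leRHS](_ : _ = M + M); last by ring.
by apply: lerD; apply: IH => t /andP[t0 t1]; apply: GM; apply/andP; split; lra.
Qed.

End dyadic_average.

Section goursat.
Context {R : realType}.
Local Notation C := R[i].
Implicit Types (F : C -> C) (z a b p : C).

(** The integrand of the integral of [F] along the boundary of the parallelogram at [z] with sides
    [a] and [b], all four sides being run through at once with the same parameter. *)
Definition contour F z a b (t : R) : C :=
  a * F (z + t%:C * a) + b * F (z + a + t%:C * b)
  - a * F (z + b + t%:C * a) - b * F (z + t%:C * b).

(** An edge shared by two of the four quarters is sampled at the same points with opposite signs, so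
    the interior contributions cancel exactly at every level [N]. *)
Lemma contour_bisect F N z a b :
  dyavg N.+1 (contour F z a b) =
  dyavg N (contour F z (a / 2) (b / 2)) +
  dyavg N (contour F (z + a / 2) (a / 2) (b / 2)) +
  dyavg N (contour F (z + b / 2) (a / 2) (b / 2)) +
  dyavg N (contour F (z + a / 2 + b / 2) (a / 2) (b / 2)).
Proof.
rewrite /= -dyavgD mulrC -dyavgZ -!dyavgD; apply: eq_dyavg => t _; rewrite /contour.
have E1 (x : C) : (t / 2)%:C * x = t%:C * (x / 2).
  by rewrite rmorphM fmorphV/= (rmorph_nat (real_complex R) 2); field.
have E2 (x : C) : ((1 + t) / 2)%:C * x = x / 2 + t%:C * (x / 2).
  by rewrite rmorphM rmorphD fmorphV/= (rmorph_nat (real_complex R) 2); field.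
rewrite !E1 !E2.
have -> : z + (a / 2 + t%:C * (a / 2)) = z + a / 2 + t%:C * (a / 2) by ring.
have -> : z + (b / 2 + t%:C * (b / 2)) = z + b / 2 + t%:C * (b / 2) by ring.
have -> : z + a / 2 + b / 2 + a / 2 + t%:C * (b / 2) =
  z + a + (b / 2 + t%:C * (b / 2)) by field.
have -> : z + b / 2 + a / 2 + t%:C * (b / 2) = z + a / 2 + b / 2 + t%:C * (b / 2) by
  ring.
have -> : z + a / 2 + a / 2 + t%:C * (b / 2) = z + a + t%:C * (b / 2) by field.
have -> : z + a / 2 + b / 2 + b / 2 + t%:C * (a / 2) =
  z + b + (a / 2 + t%:C * (a / 2)) by field.
have -> : z + b / 2 + b / 2 + t%:C * (a / 2) = z + b + t%:C * (a / 2) by field.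
by field.
Qed.

(* [contour F z a b] vanishes identically when [F] is affine. *)
Lemma contour_small F p e : 0 < e -> cdiff F p -> exists2 d, 0 < d &
  forall N z a b, cabs (z - p) + cabs a + cabs b < d ->
  cabs (dyavg N (contour F z a b)) <= e * (cabs (z - p) + cabs a + cabs b) ^+ 2.
Proof.
move=> e0 /cdiff_expandP[L hL]; have e20 : 0 < e / 2 by rewrite divr_gt0.
have [d d0 h] := hL _ e20; exists d => // N z a b; set r := _ + _ + _ => rd.
apply: dyavg_le => t /andP[t0 t1].
pose E w := F (p + w) - F p - L * w.
have -> : contour F z a b t = a * E (z - p + t%:C * a) + b * E (z - p + a + t%:C * b)
  - a * E (z - p + b + t%:C * a) - b * E (z - p + t%:C * b).
  rewrite /E /contour.
  have -> : p + (z - p + t%:C * a) = z + t%:C * a by ring.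
  have -> : p + (z - p + a + t%:C * b) = z + a + t%:C * b by ring.
  have -> : p + (z - p + b + t%:C * a) = z + b + t%:C * a by ring.
  have -> : p + (z - p + t%:C * b) = z + t%:C * b by ring.
  by ring.
have z0 := cabs_ge0 (z - p); have a0 := cabs_ge0 a; have b0 := cabs_ge0 b.
have ta (x : C) : cabs (t%:C * x) <= cabs x.
  by rewrite cabsM cabs_real ger0_norm// ler_piMl// cabs_ge0.
have Er w : cabs w <= r -> cabs (E w) <= e / 2 * r.
  move=> wr; rewrite (le_trans (h _ (le_lt_trans wr rd)))//.
  by rewrite ler_wpM2l// ltW.
have H1 := Er (z - p + t%:C * a); have H2 := Er (z - p + a + t%:C * b).
have H3 := Er (z - p + b + t%:C * a); have H4 := Er (z - p + t%:C * b).
have G1 := cabsD (z - p) (t%:C * a); have G4 := cabsD (z - p) (t%:C * b).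
have G2 := cabsD (z - p + a) (t%:C * b); have G2' := cabsD (z - p) a.
have G3 := cabsD (z - p + b) (t%:C * a); have G3' := cabsD (z - p) b.
have ta1 := ta a; have tb1 := ta b.
have {}H1 : cabs (E (z - p + t%:C * a)) <= e / 2 * r by apply: H1; rewrite /r; lra.
have {}H2 : cabs (E (z - p + a + t%:C * b)) <= e / 2 * r by apply: H2; rewrite /r; lra.
have {}H3 : cabs (E (z - p + b + t%:C * a)) <= e / 2 * r by apply: H3; rewrite /r; lra.
have {}H4 : cabs (E (z - p + t%:C * b)) <= e / 2 * r by apply: H4; rewrite /r; lra.
set x1 := E _ in H1 *; set x2 := E _ in H2 *; set x3 := E _ in H3 *; set x4 := E _ in
  H4 *.
have K1 := cabsB (a * x1 + b * x2 - a * x3) (b * x4).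
have K2 := cabsB (a * x1 + b * x2) (a * x3).
have K3 := cabsD (a * x1) (b * x2).
have M1 : cabs (a * x1) <= cabs a * (e / 2 * r) by rewrite cabsM ler_wpM2l.
have M2 : cabs (b * x2) <= cabs b * (e / 2 * r) by rewrite cabsM ler_wpM2l.
have M3 : cabs (a * x3) <= cabs a * (e / 2 * r) by rewrite cabsM ler_wpM2l.
have M4 : cabs (b * x4) <= cabs b * (e / 2 * r) by rewrite cabsM ler_wpM2l.
have T : (cabs a + cabs b) * (e * r) <= r * (e * r).
  have r0 : 0 <= r by rewrite /r !addr_ge0.
  by rewrite ler_wpM2r ?mulr_ge0 ?(ltW e0)// /r; lra.
have -> : e * r ^+ 2 = r * (e * r) by ring.
by lra.
Qed.

(** Here [P x y k] speaks of the dyadic square of side 2^-k with lower left corner (x, y): a choice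
    of one quarter at each stage shrinks to a point. *)
Lemma nested_squares (P : R -> R -> nat -> Prop) :
  P 0 0 0%N ->
  (forall x y k, P x y k -> exists x' y', [/\ x' = x \/ x' = x + 2^-1 ^+ k.+1,
     y' = y \/ y' = y + 2^-1 ^+ k.+1 & P x' y' k.+1]) ->
  exists x y, forall k, exists x' y',
    [/\ `|x' - x| <= 2^-1 ^+ k, `|y' - y| <= 2^-1 ^+ k & P x' y' k].
Proof.
move=> P0 PS.
pose T := {s : R * R * nat | P s.1.1 s.1.2 s.2}.
pose Q (s t : T) := [/\ (sval t).2 = (sval s).2.+1,
   (sval t).1.1 = (sval s).1.1 \/ (sval t).1.1 = (sval s).1.1 + 2^-1 ^+ (sval s).2.+1 &
   (sval t).1.2 = (sval s).1.2 \/ (sval t).1.2 = (sval s).1.2 + 2^-1 ^+ (sval s).2.+1].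
have step (s : T) : {t : T | Q s t}.
  apply: cid; case: s => [[[x y] k] /= Ps].
  have [x' [y' [hx hy Pt]]] := PS _ _ _ Ps.
  by exists (exist (fun s : R * R * nat => P s.1.1 s.1.2 s.2) (x', y', k.+1) Pt).
have [f [f0 fS]] := dependent_choice step
  (exist (fun s : R * R * nat => P s.1.1 s.1.2 s.2) (0, 0, 0%N) P0).
have fk k : (sval (f k)).2 = k.
  by elim: k => [|k IH]; [rewrite f0|have [-> _ _] := fS k; rewrite IH].
(* The left ends [u k] increase and the right ends u k + 2^-k decrease, so the supremum of the left
   ends lies in all the intervals. *)
have key (u : nat -> R) :
    (forall k, u k.+1 = u k \/ u k.+1 = u k + 2^-1 ^+ k.+1) ->
    exists x, forall k, `|u k - x| <= 2^-1 ^+ k.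
  move=> uS.
  have p0 k : 0 < 2^-1 ^+ k :> R by rewrite exprn_gt0// invr_gt0.
  have pS k : 2^-1 ^+ k = 2^-1 ^+ k.+1 + 2^-1 ^+ k.+1 :> R.
    by rewrite exprS; field.
  have u_le k j : u k <= u (k + j)%N.
    elim: j => [|j IH]; first by rewrite addn0.
    rewrite addnS (le_trans IH)//; have := p0 (k + j).+1.
    by case: (uS (k + j)%N) => ->; lra.
  have u_ge k j : u (k + j)%N + 2^-1 ^+ (k + j)%N <= u k + 2^-1 ^+ k.
    elim: j => [|j IH]; first by rewrite addn0.
    rewrite addnS (le_trans _ IH)// [in leRHS]pS; have := p0 (k + j).+1.
    by case: (uS (k + j)%N) => ->; lra.
  have ub k j : u j <= u k + 2^-1 ^+ k.
    have [kj|/ltnW jk] := leqP k j.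
      by have := u_ge k (j - k)%N; rewrite subnKC//; have := p0 j; lra.
    by have := u_le j (k - j)%N; rewrite subnKC//; have := p0 k; lra.
  exists (sup (range u)) => k; rewrite distrC ger0_norm.
    rewrite lerBlDr addrC; apply: ge_sup; first by exists (u 0%N), 0%N.
    by move=> _ [j _ <-]; exact: ub.
  rewrite subr_ge0; apply: ub_le_sup; last by exists k.
  by exists (u 0%N + 2^-1 ^+ 0) => _ [j _ <-]; exact: ub.
have [x hx] : exists x, forall k, `|(sval (f k)).1.1 - x| <= 2^-1 ^+ k.
  by apply: key => k; have [_ + _] := fS k; rewrite fk.
have [y hy] : exists x, forall k, `|(sval (f k)).1.2 - x| <= 2^-1 ^+ k.
  by apply: key => k; have [_ _ +] := fS k; rewrite fk.
exists x, y => k; exists (sval (f k)).1.1, (sval (f k)).1.2; split=> //.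
by have := svalP (f k); rewrite fk.
Qed.

(** A parallelogram of generation k is bad if its averages exceed the share e 4^-k for arbitrarily
    large [N]. One of the quarters of a bad one is bad, which contradicts the quadratic estimate
    [contour_small] at the limit point. *)
Lemma goursat F : (forall z, cdiff F z) -> forall z a b e, 0 < e ->
  exists N0, forall N, (N0 <= N)%N -> cabs (dyavg N (contour F z a b)) <= e.
Proof.
move=> dF z a b e e0; apply: contrapT => H.
pose P x y k := forall N0, exists2 N, (N0 <= N)%N & e * 4^-1 ^+ k <
  cabs (dyavg N (contour F (z + x%:C * a + y%:C * b)
    ((2^-1 ^+ k)%:C * a) ((2^-1 ^+ k)%:C * b))).
have P0 : P 0 0 0%N.
  move=> N0; apply: contrapT => H0; apply: H; exists N0 => N NN0.
  rewrite leNgt; apply/negP => lt; apply: H0; exists N => //.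
  by rewrite !expr0 !mul1r !mul0r !addr0 mulr1.
have PS x y k : P x y k -> exists x' y', [/\ x' = x \/ x' = x + 2^-1 ^+ k.+1,
     y' = y \/ y' = y + 2^-1 ^+ k.+1 & P x' y' k.+1].
  move=> Pk; apply: contrapT => nP.
  have small x' y' : x' = x \/ x' = x + 2^-1 ^+ k.+1 ->
      y' = y \/ y' = y + 2^-1 ^+ k.+1 -> exists N0, forall N, (N0 <= N)%N ->
      cabs (dyavg N (contour F (z + x'%:C * a + y'%:C * b)
        ((2^-1 ^+ k.+1)%:C * a) ((2^-1 ^+ k.+1)%:C * b))) <= e * 4^-1 ^+ k.+1.
    move=> hx hy; apply: contrapT => nN; apply: nP; exists x', y'; split => // N0.
    apply: contrapT => n2; apply: nN; exists N0 => N NN0.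
    by rewrite leNgt; apply/negP => lt; apply: n2; exists N.
  have [N1 h1] := small x y (or_introl erefl) (or_introl erefl).
  have [N2 h2] := small _ y (or_intror erefl) (or_introl erefl).
  have [N3 h3] := small x _ (or_introl erefl) (or_intror erefl).
  have [N4 h4] := small _ _ (or_intror erefl) (or_intror erefl).
  (* Bisecting uses up one level of the average, hence the successor. *)
  have [[//|N] NN] := Pk (maxn (maxn N1 N2) (maxn N3 N4)).+1.
  rewrite contour_bisect ltNge => /negP; apply.
  have hlf (c : C) : (2^-1 ^+ k)%:C * c / 2 = (2^-1 ^+ k.+1)%:C * c.
    by rewrite exprS rmorphM/= fmorphV/= (rmorph_nat (real_complex R) 2); field.
  rewrite !hlf.
  move: NN; rewrite ltnS !geq_max => /andP[/andP[l1 l2] /andP[l3 l4]].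
  have {}h1 := h1 _ l1; have {}h2 := h2 _ l2.
  have {}h3 := h3 _ l3; have {}h4 := h4 _ l4.
  rewrite rmorphD/= mulrDl in h2; rewrite rmorphD/= mulrDl in h3.
  rewrite !rmorphD/= !mulrDl in h4.
  have E1 : z + (x%:C * a + (2^-1 ^+ k.+1)%:C * a) + y%:C * b =
    z + x%:C * a + y%:C * b + (2^-1 ^+ k.+1)%:C * a by ring.
  have E2 : z + x%:C * a + (y%:C * b + (2^-1 ^+ k.+1)%:C * b) =
    z + x%:C * a + y%:C * b + (2^-1 ^+ k.+1)%:C * b by ring.
  have E3 : z + (x%:C * a + (2^-1 ^+ k.+1)%:C * a) + (y%:C * b + (2^-1 ^+ k.+1)%:C *
    b) =
    z + x%:C * a + y%:C * b + (2^-1 ^+ k.+1)%:C * a + (2^-1 ^+ k.+1)%:C * b by ring.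
  rewrite E1 in h2; rewrite E2 in h3; rewrite E3 in h4.
  rewrite (le_trans (cabsD _ _))//.
  set A := _ + _ + _ in h2 h3 h4 *.
  have := cabsD (dyavg N (contour F (z + x%:C * a + y%:C * b) ((2^-1 ^+ k.+1)%:C * a)
    ((2^-1 ^+ k.+1)%:C * b))
    + dyavg N (contour F (z + x%:C * a + y%:C * b + (2^-1 ^+ k.+1)%:C * a)
    ((2^-1 ^+ k.+1)%:C * a) ((2^-1 ^+ k.+1)%:C * b))) (dyavg N (contour F (z + x%:C *
      a + y%:C * b + (2^-1 ^+ k.+1)%:C * b)
    ((2^-1 ^+ k.+1)%:C * a) ((2^-1 ^+ k.+1)%:C * b))).
  have := cabsD (dyavg N (contour F (z + x%:C * a + y%:C * b) ((2^-1 ^+ k.+1)%:C * a)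
    ((2^-1 ^+ k.+1)%:C * b)))
    (dyavg N (contour F (z + x%:C * a + y%:C * b + (2^-1 ^+ k.+1)%:C * a)
    ((2^-1 ^+ k.+1)%:C * a) ((2^-1 ^+ k.+1)%:C * b))).
  have : e * 4^-1 ^+ k = 4 * (e * 4^-1 ^+ k.+1) by rewrite exprS; field.
  by lra.
have [x [y hxy]] := nested_squares P0 PS.
pose p := z + x%:C * a + y%:C * b; pose M := cabs a + cabs b.
have M0 : 0 <= M by rewrite addr_ge0 ?cabs_ge0.
(* The factor 4 M^2 comes from (2 M 2^-k)^2 below; adding 1 covers the degenerate case M = 0. *)
have e'0 : 0 < e / (4 * M ^+ 2 + 1) by rewrite divr_gt0// ltr_wpDl// mulr_ge0// sqr_ge0.
have [d d0 hd] := contour_small e'0 (dF p).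
have [k kd] : exists k, 2 * M * 2^-1 ^+ k < d.
  pose m := Num.truncn (2 * M / d); exists m.+1.
  have : 2 * M / d < m.+1%:R by rewrite truncnS_gt.
  rewrite ltr_pdivrMr// => lt; rewrite exprVn ltr_pdivrMr ?exprn_gt0//.
  rewrite (lt_trans lt)// mulrC ltr_pM2l// -natrX ltr_nat.
  exact: (ltn_expl m.+1 (isT : 1 < 2)%N).
have [x' [y' [hx hy /(_ 0%N)[N _]]]] := hxy k.
rewrite ltNge => /negP; apply.
have r0 : 0 < 2^-1 ^+ k :> R by rewrite exprn_gt0// invr_gt0.
set r := 2^-1 ^+ k in hx hy r0 kd *.
have rn (c : C) : cabs (r%:C * c) = r * cabs c by rewrite cabsM cabs_real gtr0_norm.
have small : cabs (z + x'%:C * a + y'%:C * b - p) + cabs (r%:C * a) + cabs (r%:C * b)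
  <= 2 * M * r.
  rewrite !rn; have -> : z + x'%:C * a + y'%:C * b - p = (x' - x)%:C * a + (y' -
    y)%:C * b.
    by rewrite /p !rmorphB/=; ring.
  have := cabsD ((x' - x)%:C * a) ((y' - y)%:C * b); rewrite !cabsM !cabs_real.
  have : `|x' - x| * cabs a <= r * cabs a by rewrite ler_wpM2r// cabs_ge0.
  have : `|y' - y| * cabs b <= r * cabs b by rewrite ler_wpM2r// cabs_ge0.
  have -> : 2 * M * r = r * cabs a + r * cabs b + r * cabs a + r * cabs b by rewrite
    /M; ring.
  by lra.
rewrite (le_trans (hd N _ _ _ (le_lt_trans small kd)))//.
have -> : 4^-1 ^+ k = r ^+ 2 :> R.
  by rewrite /r -exprM mulnC exprM; congr (_ ^+ k); field.
have : (cabs (z + x'%:C * a + y'%:C * b - p) + cabs (r%:C * a) + cabs (r%:C * b)) ^+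
  2 <= (2 * M * r) ^+ 2.
  by rewrite ler_sqr ?nnegrE// ?addr_ge0 ?cabs_ge0// ?mulr_ge0// ltW.
move=> /(ler_wpM2l (ltW e'0)) /le_trans; apply.
have -> : (2 * M * r) ^+ 2 = (4 * M ^+ 2) * r ^+ 2 by ring.
rewrite mulrA ler_wpM2r ?sqr_ge0// mulrAC ler_pdivrMr; last by rewrite ltr_wpDl//
  mulr_ge0// sqr_ge0.
by rewrite ler_wpM2l ?(ltW e0)//; lra.
Qed.

(** The map w e^s turns circles into vertical segments. In the rectangle with sides -rho and 2 pi i
    the two sides along -rho cancel by periodicity, so Goursat's theorem compares the mean over the
    circle of radius |w| with that over the radius |w| e^(-rho), where [h] is close to [h 0]. *)
Lemma circle_mean h (w : C) : (forall z, cdiff h z) -> forall e, 0 < e ->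
  exists N0, forall N, (N0 <= N)%N ->
  cabs (dyavg N (fun t => h (w * cexp (t%:C * (0 +i* (pi *+ 2))))) - h 0) <= e.
Proof.
move=> dh e e0; set b : C := 0 +i* (pi *+ 2).
have e20 : 0 < e / 2 by rewrite divr_gt0.
have [d d0 hd] := cdiff_cont (dh 0) e20.
(* Since e^rho >= 1 + rho > |w|/d, the inner circle has radius less than d. *)
pose rho := cabs w / d.
have rho0 : 0 <= rho by rewrite divr_ge0 ?cabs_ge0// ltW.
have wd : cabs w * expR (- rho) < d.
  rewrite expRN ltr_pdivrMr ?expR_gt0// mulrC -ltr_pdivrMr//.
  by rewrite -/rho (lt_le_trans _ (expR_ge1Dx _))//; lra.
pose F s := h (w * cexp s).
have dF s : cdiff F s.
  apply: (@cdiff_comp _ h (fun s => w * cexp s)) => //.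
  by apply: cdiffM; [exact: cdiff_cst|exact: cdiff_cexp].
have b1 : 1 <= cabs b.
  have p2 : 1 <= pi *+ 2 :> R by have := @pi_ge2 R; lra.
  by rewrite cabsE/= expr0n add0r sqrtr_sqr ger0_norm// (le_trans ler01).
have [N0 hN] := goursat dF 0 (- rho)%:C b e20.
exists N0 => N /hN; set A := dyavg N _; set B := dyavg N _.
have -> : A = b * (dyavg N (fun t => h (w * cexp (- rho)%:C * cexp (t%:C * b))) - B).
  rewrite /A /B mulrBr -!dyavgZ -[- dyavg _ _]mulN1r -dyavgZ -dyavgD.
  apply: eq_dyavg => t _; rewrite /contour /F !add0r mulN1r.
  by rewrite [b + _]addrC cexpD2pii cexpD mulrA; ring.
rewrite {A} cabsM => le1. set A := dyavg N _ in le1.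
have le2 : cabs (A - B) <= e / 2.
  by rewrite (le_trans _ le1)// ler_peMl// cabs_ge0.
have le3 : cabs (A - h 0) <= e / 2.
  have -> : A - h 0 = dyavg N (fun t => h (w * cexp (- rho)%:C * cexp (t%:C * b)) - h
    0).
    by rewrite dyavgD dyavg_cst.
  apply: dyavg_le => t _; have := hd (w * cexp (- rho)%:C * cexp (t%:C * b)).
  rewrite !add0r; apply; rewrite !cabsM !cabs_cexp/=.
  by rewrite mulr0 mul0r subr0 expR0 mulr1.
have := cabsB (A - h 0) (A - B); have -> : A - h 0 - (A - B) = B - h 0 by ring.
by lra.
Qed.

Lemma circle_bound h (z : C) r M : (forall z, cdiff h z) -> 0 <= r ->
  (forall w, cabs (w - z) = r -> cabs (h w) <= M) -> cabs (h z) <= M.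
Proof.
move=> dh r0 hM; apply/ler_addgt0Pr => e e0.
have dg w : cdiff (fun w => h (z + w)) w.
  apply: (@cdiff_comp _ h (fun w => z + w)) => //.
  by apply: cdiffD; [exact: cdiff_cst|exact: cdiff_id].
have [N /(_ _ (leqnn N))] := circle_mean r%:C dg e0; rewrite addr0.
set A := dyavg _ _ => AB.
have AM : cabs A <= M.
  apply: dyavg_le => t _; apply: hM.
  rewrite addrC addKr cabsM cabs_cexp cabs_real ger0_norm//=.
  by rewrite mulr0 mul0r subr0 expR0 mulr1.
have := cabsB A (A - h z); have -> : A - (A - h z) = h z by ring.
by lra.
Qed.

(* [(h t - h 0) ^+ 2 / t] is complex differentiable at [0] too. *)
Lemma schwarz h M r : (forall z, cdiff h z) -> 1 < r ->
  (forall w, cabs w <= r + 1 -> cabs (h w) <= M) ->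
  cabs (h 1 - h 0) ^+ 2 <= 4 * M ^+ 2 / (r - 1).
Proof.
move=> dh r1 hM.
have dh0 z : cdiff (fun t => h t - h 0) z.
  by apply: cdiffD => //; exact: cdiff_cst.
pose k t := (h t - h 0) ^+ 2 * t^-1.
have dk z : cdiff k z.
  have [->|z0] := eqVneq z 0; last by apply: cdiffM; [exact: cdiffX|exact: cdiffV].
  have [q cq hq] := dh 0.
  (* The slope [q] of h at 0 is only known to be continuous at 0, so (h t - h 0) / t is not yet
     known to be differentiable there. The square of the increment over t is t q(t)^2, with slope
     q^2, and its value 0 at t = 0 agrees with [invr0]. *)
  exists (fun w => q w * q w); first exact: cont0M.
  move=> w; rewrite /k add0r subrr expr0n mul0r add0r -[in h w](add0r w) hq.
  have [->|w0] := eqVneq w 0; first by rewrite invr0 mulr0 mul0r.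
  by rewrite addrC addKr; field.
have r0 : 0 <= r by lra.
(* The circle is centred at the point 1 to be estimated, so that r - 1 <= |w| <= r + 1 on it. *)
have := circle_bound dk r0 _ (z := 1) (M := 4 * M ^+ 2 / (r - 1)).
rewrite {2}/k invr1 mulr1 cabsX; apply => w wr.
have w2 : r - 1 <= cabs w.
  have := cabsB w (w - 1); have := cabsB w w.
  have := cabsD (w - 1) 1.
  have := cabsB (w - 1) w; have -> : w - 1 - w = - 1 by ring.
  by have := cabsD w (- 1); rewrite cabsN cabs1; lra.
have w3 : cabs w <= r + 1.
  by have := cabsD (w - 1) 1; rewrite subrK cabs1; lra.
have M1 := hM _ w3; have M2 : cabs (h 0) <= M by apply: hM; rewrite cabs0; lra.
rewrite /k cabsM cabsX cabsV ler_pM ?sqr_ge0 ?invr_ge0 ?cabs_ge0//.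
  have := cabsB (h w) (h 0) => H.
  have -> : 4 * M ^+ 2 = (2 * M) ^+ 2 by ring.
  rewrite ler_sqr ?nnegrE ?cabs_ge0//; last by have := cabs_ge0 (h 0); lra.
  by lra.
by rewrite lef_pV2// posrE; lra.
Qed.

(** Because [h] vanishes near 0, h(t) / t^m is entire for every m. On the circle of radius 3|z|
    about z one has 2|z| <= |t| <= 4|z|, so the mean value property gives |h z| <= M 2^-m. *)
Lemma identity_theorem h d z M : (forall z, cdiff h z) -> 0 < d ->
  (forall w, cabs w < d -> h w = 0) ->
  (forall w, cabs w <= 4 * cabs z -> cabs (h w) <= M) -> h z = 0.
Proof.
move=> dh d0 h0 hM.
have [->|z0] := eqVneq z 0; first by rewrite h0// cabs0.
have zg0 : 0 < cabs z by rewrite cabs_gt0.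
have M0 : 0 <= M by rewrite (le_trans (cabs_ge0 (h z)))// hM//; lra.
have key m : cabs (h z) <= M * 2^-1 ^+ m.
  pose k t := h t * t^-1 ^+ m.
  have dk t : cdiff k t.
    have [->|t0] := eqVneq t 0; last by apply: cdiffM => //; apply: cdiffX; exact:
      cdiffV.
    apply: (@cdiff_near _ _ (fun=> 0) _ _ d0); last exact: cdiff_cst.
    by move=> w wd; rewrite /k add0r h0// mul0r.
  have r0 : 0 <= 3 * cabs z by lra.
  have := circle_bound dk r0 _ (z := z) (M := M * (2 * cabs z)^-1 ^+ m).
  rewrite {2}/k cabsM cabsX cabsV -ler_pdivlMr ?exprn_gt0 ?invr_gt0// => H.
  apply: le_trans (H _) _ => [w wr|].
    have w2 : 2 * cabs z <= cabs w.
      by have := cabsB w z; lra.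
    have w4 : cabs w <= 4 * cabs z by have := cabsD (w - z) z; rewrite subrK; lra.
    rewrite /k cabsM cabsX cabsV ler_pM ?exprn_ge0 ?invr_ge0 ?cabs_ge0 ?hM//.
    by rewrite lerXn2r ?nnegrE ?invr_ge0 ?cabs_ge0//; [lra|rewrite lef_pV2// posrE;
      lra].
  rewrite invfM exprMn mulrA mulfK//.
  by rewrite expf_neq0// invr_neq0// cabs_eq0.
apply: cabs_arb => e e0; pose m := Num.truncn (M / e).
apply: le_trans (key m.+1) _.
have : M / e < m.+1%:R by rewrite truncnS_gt.
rewrite ltr_pdivrMr// => lt; rewrite exprVn ler_pdivrMr ?exprn_gt0//.
rewrite (le_trans (ltW lt))// mulrC ler_pM2l// -natrX ler_nat.
exact: ltnW (ltn_expl m.+1 (isT : 1 < 2)%N).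
Qed.

End goursat.

(** * Complex-valued integrals *)
Section ReIm.
Context {R : realType}.
Implicit Types z w : R[i].

Lemma ReD z w : complex.Re (z + w) = complex.Re z + complex.Re w.
Proof. by case: z w => ? ? []. Qed.

Lemma ImD z w : complex.Im (z + w) = complex.Im z + complex.Im w.
Proof. by case: z w => ? ? []. Qed.

Lemma ReM z w : complex.Re (z * w) =
  complex.Re z * complex.Re w - complex.Im z * complex.Im w.
Proof. by case: z w => ? ? []. Qed.

Lemma ImM z w : complex.Im (z * w) =
  complex.Re z * complex.Im w + complex.Im z * complex.Re w.
Proof. by case: z w => ? ? []. Qed.

Lemma Re_conj z : complex.Re (conjc z) = complex.Re z.
Proof. by case: z. Qed.

Lemma Im_conj z : complex.Im (conjc z) = - complex.Im z.
Proof. by case: z. Qed.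

Lemma conjcD z w : conjc (z + w) = conjc z + conjc w.
Proof. exact: rmorphD. Qed.

Lemma conjcM z w : conjc (z * w) = conjc z * conjc w.
Proof. exact: rmorphM. Qed.

End ReIm.

Section cmeas.
Context d (T : measurableType d) {R : realType}.
Local Notation C := R[i].
Implicit Types (F G : T -> C) (g : T -> R).

Definition cmeas F := measurable_fun setT (fun x => complex.Re (F x)) /\
  measurable_fun setT (fun x => complex.Im (F x)).

Lemma cmeas_cst (c : C) : cmeas (fun=> c).
Proof. by split; exact: measurable_cst. Qed.

Lemma cmeas_real g : measurable_fun setT g -> cmeas (fun x => (g x)%:C).
Proof. by split => //; exact: measurable_cst. Qed.

Lemma cmeasD F G : cmeas F -> cmeas G -> cmeas (fun x => F x + G x).
Proof.
move=> [F1 F2] [G1 G2]; split.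
  under [X in measurable_fun _ X]funext do rewrite ReD; exact: measurable_funD.
under [X in measurable_fun _ X]funext do rewrite ImD; exact: measurable_funD.
Qed.

Lemma cmeasM F G : cmeas F -> cmeas G -> cmeas (fun x => F x * G x).
Proof.
move=> [F1 F2] [G1 G2]; split.
  under [X in measurable_fun _ X]funext do rewrite ReM.
  by apply: measurable_funB; exact: measurable_funM.
under [X in measurable_fun _ X]funext do rewrite ImM.
by apply: measurable_funD; exact: measurable_funM.
Qed.

Lemma cmeas_conj F : cmeas F -> cmeas (fun x => conjc (F x)).
Proof.
move=> [F1 F2]; split.
  by under [X in measurable_fun _ X]funext do rewrite Re_conj.
under [X in measurable_fun _ X]funext do rewrite Im_conj.
exact: measurableT_comp.
Qed.

Lemma cmeas_cexp F : cmeas F -> cmeas (fun x => cexp (F x)).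
Proof.
move=> [F1 F2]; split.
  apply: measurable_funM; first exact: measurableT_comp.
  by apply: measurableT_comp => //; apply: continuous_measurable_fun; exact:
    continuous_cos.
apply: measurable_funM; first exact: measurableT_comp.
by apply: measurableT_comp => //; apply: continuous_measurable_fun; exact:
  continuous_sin.
Qed.

Lemma cmeas_sum (I : Type) (s : seq I) (F : I -> T -> C) :
  (forall i, cmeas (F i)) -> cmeas (fun x => \sum_(i <- s) F i x).
Proof.
move=> mF; elim: s => [|i s IH].
  by under [X in cmeas X]funext do rewrite big_nil; exact: cmeas_cst.
by under [X in cmeas X]funext do rewrite big_cons; exact: cmeasD.
Qed.

End cmeas.

Lemma cmeas_comp d (T : measurableType d) (R : realType) d' (T' : measurableType d')
  (phi : T' -> T) (F : T -> R[i]) : cmeas F -> measurable_fun setT phi -> cmeas (F \o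
    phi).
Proof.
by move=> [F1 F2] mphi; split; [exact: (measurableT_comp F1)|exact: (measurableT_comp
  F2)].
Qed.

Section cint.
Context d (T : measurableType d) {R : realType} (mu : {measure set T -> \bar R}).
Local Notation C := R[i].
Implicit Types (F G : T -> C) (g : T -> R).

Definition rintble g := mu.-integrable setT (EFin \o g).

Definition cintble F :=
  rintble (fun x => complex.Re (F x)) /\ rintble (fun x => complex.Im (F x)).

Definition cint F : C := (\int[mu]_x complex.Re (F x)) +i* (\int[mu]_x complex.Im (F
  x)).

Lemma rintble_le g h : measurable_fun setT g -> (forall x, `|g x| <= h x) ->
  rintble h -> rintble g.
Proof.
move=> mg gh ih; apply: (le_integrable _ _ _ ih) => //; first exact/measurable_EFinP.
by move=> x _ /=; rewrite lee_fin (le_trans (gh x))// ler_norm.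
Qed.

Lemma cintble_le F g : cmeas F -> (forall x, cabs (F x) <= g x) -> rintble g ->
  cintble F.
Proof.
move=> [F1 F2] Fg ig; split; apply: (rintble_le _ _ ig) => // x.
  exact: le_trans (cabs_Re _) (Fg x).
exact: le_trans (cabs_Im _) (Fg x).
Qed.

Lemma eq_cint F G : F =1 G -> cint F = cint G.
Proof. by move=> /funext ->. Qed.

Lemma rintbleD g h : rintble g -> rintble h -> rintble (fun x => g x + h x).
Proof.
move=> ig ih; rewrite /rintble [_ \o _](_ : _ = (EFin \o g) \+ (EFin \o h))%E//.
exact: integrableD.
Qed.

Lemma rintbleZ (a : R) g : rintble g -> rintble (fun x => a * g x).
Proof.
move=> ig; rewrite /rintble [_ \o _](_ : _ = (fun x => a%:E * (EFin \o g) x))%E//.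
exact: integrableZl.
Qed.

Lemma cintbleD F G : cintble F -> cintble G -> cintble (fun x => F x + G x).
Proof.
move=> [F1 F2] [G1 G2]; split.
  under [X in rintble X]funext do rewrite ReD; exact: rintbleD.
under [X in rintble X]funext do rewrite ImD; exact: rintbleD.
Qed.

Lemma cintbleZ (c : C) F : cintble F -> cintble (fun x => c * F x).
Proof.
move=> [F1 F2]; split.
  under [X in rintble X]funext do rewrite ReM -mulNr.
  by apply: rintbleD; exact: rintbleZ.
under [X in rintble X]funext do rewrite ImM.
by apply: rintbleD; exact: rintbleZ.
Qed.

Lemma cintD F G : cintble F -> cintble G ->
  cint (fun x => F x + G x) = cint F + cint G.
Proof.
move=> [F1 F2] [G1 G2]; rewrite /cint.
under eq_Rintegral do rewrite ReD.
under [X in _ +i* X = _]eq_Rintegral do rewrite ImD.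
by rewrite !RintegralD.
Qed.

Lemma cintZ (c : C) F : cintble F -> cint (fun x => c * F x) = c * cint F.
Proof.
move=> [F1 F2]; rewrite /cint.
under eq_Rintegral do rewrite ReM.
under [X in _ +i* X = _]eq_Rintegral do rewrite ImM.
rewrite RintegralB//; [|exact: rintbleZ|exact: rintbleZ].
rewrite RintegralD//; [|exact: rintbleZ|exact: rintbleZ].
by rewrite !RintegralZl//; case: c.
Qed.

Lemma cint_conj F : cintble F -> cint (fun x => conjc (F x)) = conjc (cint F).
Proof.
move=> [F1 F2]; rewrite /cint/=; congr (_ +i* _).
  by under eq_Rintegral do rewrite Re_conj.
under eq_Rintegral do rewrite Im_conj -mulN1r.
by rewrite RintegralZl// mulN1r.
Qed.

(** Real and imaginary parts are estimated separately, whence the harmless factor 2. *)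
Lemma le_cint F g : cmeas F -> (forall x, cabs (F x) <= g x) -> rintble g ->
  cabs (cint F) <= 2 * \int[mu]_x g x.
Proof.
move=> mF Fg ig; have [F1 F2] := cintble_le mF Fg ig.
rewrite (le_trans (cabs_le_ReIm _))//= [leRHS](_ : _ = \int[mu]_x g x + \int[mu]_x g
  x); last by ring.
have i1 : rintble (fun x => `|complex.Re (F x)|).
  by apply: rintble_le ig; [exact: measurableT_comp mF.1|move=> x; rewrite normr_id
    (le_trans (cabs_Re _))].
have i2 : rintble (fun x => `|complex.Im (F x)|).
  by apply: rintble_le ig; [exact: measurableT_comp mF.2|move=> x; rewrite normr_id
    (le_trans (cabs_Im _))].
apply: lerD; rewrite (le_trans (le_normr_Rintegral _ _))//; apply: le_Rintegral => //
  x _.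
  exact: le_trans (cabs_Re _) (Fg x).
exact: le_trans (cabs_Im _) (Fg x).
Qed.

(** Dominated convergence for a sequence of constant integral, which is the situation created by
    averaging over rotations. *)
Lemma cint_dominated (F_ : nat -> T -> C) F g (c : C) :
  (forall N, cmeas (F_ N)) -> cmeas F ->
  (forall N x, cabs (F_ N x) <= g x) -> rintble g ->
  (forall x e, 0 < e -> exists N0, forall N, (N0 <= N)%N -> cabs (F_ N x - F x) <= e) ->
  (forall N, cint (F_ N) = c) -> cint F = c.
Proof.
move=> mF_ mF Fg ig cvF cF.
have key (p : C -> R) : (forall z, `|p z| <= cabs z) -> (forall z w, p (z - w) = p z
  - p w) ->
    (forall N, measurable_fun setT (fun x => p (F_ N x))) ->
    measurable_fun setT (fun x => p (F x)) ->
    (forall N, \int[mu]_x p (F_ N x) = p c) -> \int[mu]_x p (F x) = p c.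
  move=> pn pB mp_ mp pc.
  have [||||_ _] := @dominated_convergence _ _ _ mu setT measurableT
    (fun N x => (p (F_ N x))%:E) (fun x => (p (F x))%:E) (EFin \o g) _ _ _ ig _.
  - by move=> N; exact/measurable_EFinP.
  - exact/measurable_EFinP.
  - apply/aeW => x _; apply: cvg_EFin; first exact: nearW.
    apply/cvgrPdist_le => e e0; have [N0 hN0] := cvF x e e0.
    exists N0 => // N /= NN0; rewrite distrC -pB (le_trans (pn _))//.
    exact: hN0.
  - by apply/aeW => x N _ /=; rewrite lee_fin (le_trans (pn _)).
  have -> : [sequence (\int[mu]_x (p (F_ n x))%:E)%E]_n = fun=> (p c)%:E.
    apply/funext => N /=; rewrite -(pc N) /Rintegral fineK//.
    apply: integrable_fin_num => //; apply: (rintble_le _ _ ig) => // x.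
    by rewrite (le_trans (pn _)).
  move=> H; rewrite /Rintegral; suff -> : (\int[mu]_x (p (F x))%:E)%E = (p c)%:E by [].
  by move/cvg_lim : H => <-//; rewrite lim_cst.
rewrite /cint (key (@complex.Re R)) ?(key (@complex.Im R)).
- by case: c {key cF}.
- exact: cabs_Im.
- by move=> [? ?] [].
- by move=> N; exact: (mF_ N).2.
- exact: mF.2.
- by move=> N; rewrite -(cF N).
- exact: cabs_Re.
- by move=> [? ?] [].
- by move=> N; exact: (mF_ N).1.
- exact: mF.1.
- by move=> N; rewrite -(cF N).
Qed.

End cint.

Section cint_pushforward.
Context d1 d2 (T1 : measurableType d1) (T2 : measurableType d2) {R : realType}.
Variables (m1 : {measure set T1 -> \bar R}) (m2 : {measure set T2 -> \bar R}).
Variables (phi : T1 -> T2) (mphi : measurable_fun setT phi).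
(** An equality on measurable sets covers both the image measures that define the measure on C^n and
    the maps of the plane that preserve Lebesgue measure. *)
Hypothesis pushE : forall A, measurable A -> m2 A = m1 (phi @^-1` A).
Local Notation C := R[i].

Let push : {measure set T2 -> \bar R} :=
  measure_function_pushforward__canonical__measure_function_Measure m1 mphi.

Lemma rintble_push (g : T2 -> R) : measurable_fun setT g -> rintble m1 (g \o phi) ->
  rintble m2 g.
Proof.
move=> mg ig.
have /integrableP[_ h] := @integrable_pushforward _ _ _ _ _ _ mphi m1 setT
  (EFin \o g) ((measurable_EFinP _ _).2 mg) ig measurableT.
apply/integrableP; split; first exact/measurable_EFinP.
by rewrite (eq_measure_integral push)// => A mA _; rewrite pushE.
Qed.

Lemma Rintegral_push (g : T2 -> R) : measurable_fun setT g -> rintble m1 (g \o phi) ->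
  \int[m2]_y g y = \int[m1]_x g (phi x).
Proof.
move=> mg ig; rewrite /Rintegral; congr fine.
rewrite (eq_measure_integral push); last by move=> A mA _; rewrite pushE.
by rewrite (integral_pushforward mphi ((measurable_EFinP _ _).2 mg) ig).
Qed.

Lemma cint_push (F : T2 -> C) : cmeas F -> cintble m1 (F \o phi) ->
  cint m2 F = cint m1 (F \o phi).
Proof. by move=> [F1 F2] [i1 i2]; rewrite /cint !Rintegral_push. Qed.

End cint_pushforward.

Section cint_fubini.
Context d1 d2 (T1 : measurableType d1) (T2 : measurableType d2) {R : realType}.
Variable m1 : {sigma_finite_measure set T1 -> \bar R}.
Variable m2 : {sigma_finite_measure set T2 -> \bar R}.
Local Notation C := R[i].
Local Notation m12 := (sigma_finite_prod m1 m2).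

Lemma rintble_prod (a : T1 -> R) (b : T2 -> R) : (forall x, 0 <= a x) -> (forall y, 0
  <= b y) ->
  rintble m1 a -> rintble m2 b -> rintble m12 (fun p => a p.1 * b p.2).
Proof.
move=> a0 b0 ia ib.
have ma : measurable_fun setT a by exact/measurable_EFinP/(measurable_int _ ia).
have mb : measurable_fun setT b by exact/measurable_EFinP/(measurable_int _ ib).
apply/integrable12ltyP.
  apply/measurable_EFinP; apply: measurable_funM.
    exact: (measurableT_comp ma).
  exact: (measurableT_comp mb).
rewrite /= (_ : (fun x => _) = (fun x => (a x)%:E * \int[m2]_y (b y)%:E)%E); last first.
  apply/funext => x; rewrite -ge0_integralZl//; first last.
  - by rewrite lee_fin.
  - by move=> y _; rewrite lee_fin.
  - exact/measurable_EFinP.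
  by apply: eq_integral => y _; rewrite ger0_norm ?mulr_ge0// EFinM.
rewrite ge0_integralZr//; first last.
- by apply: integral_ge0 => y _; rewrite lee_fin.
- by move=> x _; rewrite lee_fin.
- exact/measurable_EFinP.
apply: lte_mul_pinfty.
- by apply: integral_ge0 => y _; rewrite lee_fin.
- exact: integrable_fin_num.
- by rewrite ltey_eq (integrable_fin_num _ ib).
Qed.

(** All sections are assumed integrable, not just almost all, so that every inner integral is finite
    and [fine] loses nothing. *)
Lemma Rintegral_fubini (f : T1 * T2 -> R) : rintble m12 f ->
  (forall x, rintble m2 (fun y => f (x, y))) -> (forall y, rintble m1 (fun x => f (x,
    y))) ->
  \int[m12]_p f p = \int[m1]_x \int[m2]_y f (x, y) /\
  \int[m12]_p f p = \int[m2]_y \int[m1]_x f (x, y).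
Proof.
move=> fi f2 f1; rewrite /Rintegral; split; congr fine.
  rewrite -[LHS](integral12_prod_meas1 fi); apply: eq_integral => x _.
  by rewrite fineK// (integrable_fin_num _ (f2 x)).
rewrite -[LHS](integral21_prod_meas1 fi); apply: eq_integral => y _.
by rewrite fineK// (integrable_fin_num _ (f1 y)).
Qed.

Lemma cint_fubini (F : T1 * T2 -> C) (a : T1 -> R) (b : T2 -> R) : cmeas F ->
  (forall x y, cabs (F (x, y)) <= a x * b y) -> rintble m1 a -> rintble m2 b ->
  (forall x, 0 <= a x) -> (forall y, 0 <= b y) ->
  cint m12 F = cint m1 (fun x => cint m2 (fun y => F (x, y))) /\
  cint m12 F = cint m2 (fun y => cint m1 (fun x => F (x, y))).
Proof.
move=> mF Fab ia ib a0 b0.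
have [F1 F2] : cintble m12 F.
  by apply: (cintble_le mF _ (rintble_prod a0 b0 ia ib)) => -[x y]; exact: Fab.
have i2 x : cintble m2 (fun y => F (x, y)).
  apply: (cintble_le _ (Fab x) (rintbleZ (a x) ib)).
  by apply: (cmeas_comp (phi := fun y => (x, y)) mF); exact: measurable_pair1.
have i1 y : cintble m1 (fun x => F (x, y)).
  apply: (@cintble_le _ _ _ _ _ (fun x => b y * a x)); last exact: rintbleZ.
    by apply: (cmeas_comp (phi := fun x => (x, y)) mF); exact: measurable_pair2.
  by move=> x; rewrite mulrC; exact: Fab.
rewrite /cint/=.
have [A1 A2] := Rintegral_fubini F1 (fun x => (i2 x).1) (fun y => (i1 y).1).
have [B1 B2] := Rintegral_fubini F2 (fun x => (i2 x).2) (fun y => (i1 y).2).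
by rewrite -A1 -A2 -B1 -B2.
Qed.

Lemma cintble_fubini (F : T1 * T2 -> C) (a : T1 -> R) (b : T2 -> R) : cmeas F ->
  (forall x y, cabs (F (x, y)) <= a x * b y) -> rintble m1 a -> rintble m2 b ->
  (forall x, 0 <= a x) -> (forall y, 0 <= b y) -> cintble m12 F.
Proof.
move=> mF Fab ia ib a0 b0.
by apply: (cintble_le mF _ (rintble_prod a0 b0 ia ib)) => -[x y]; exact: Fab.
Qed.

End cint_fubini.

(** * The Gaussian mean value property in the plane *)
Section gaussC.
Context {R : realType}.
Implicit Types w : R[i].

Lemma cabs2E w : (cabs w ^+ 2)%:C = w * conjc w.
Proof. by rewrite rmorphXn/= -normCE sqr_normc. Qed.

Lemma gaussCE w : (expR (- 1 * cabs w ^+ 2))%:C = cexp (- (w * conjc w)).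
Proof. by rewrite -cabs2E /cexp/= oppr0 cos0 sin0 mulr1 mulr0 mulN1r. Qed.

End gaussC.

Section plane.
Context {R : realType}.
Local Notation C := R[i].
Local Notation RR := (measurableTypeR R * measurableTypeR R)%type.
Local Notation leb := (@lebesgue_measure R).

Local Notation leb2 := (sigma_finite_prod leb leb).

Lemma lebesgue_translation (a : R) (A : set (measurableTypeR R)) : measurable A ->
  leb A = leb ((fun x => x + a) @^-1` A).
Proof.
move=> mA.
have ma : measurable_fun setT (fun x : measurableTypeR R => x + a : measurableTypeR R).
  by apply: (@measurable_funD _ _ R setT id (cst a)).
pose mu := measure_function_pushforward__canonical__measure_function_Measure leb ma.
apply: (@lebesgue_measure_unique _ mu) => // X /ocitvP[->|[[u v] /= uv ->]].
  by rewrite !measure0.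
rewrite /mu/= /pushforward [_ @^-1` _](_ : _ = `]u - a, v - a]%classic).
  by rewrite !lebesgue_measure_itv/= !lte_fin ltrD2r uv -!EFinB; congr (_%:E); ring.
by apply/seteqP; split => x /=; rewrite !in_itv/= ltrBlDr lerBrDr.
Qed.

Definition preserves_leb2 (T : RR -> RR) := measurable_fun setT T /\
  forall A, measurable A -> leb2 A = leb2 (T @^-1` A).

Lemma preserves_leb2_comp S T : preserves_leb2 S -> preserves_leb2 T ->
  preserves_leb2 (S \o T).
Proof.
move=> [mS hS] [mT hT]; split; first exact: measurableT_comp.
move=> A mA; have mSA : measurable (S @^-1` A).
  by rewrite -[X in measurable X]setTI; exact: mS.
by rewrite (hS A mA) (hT _ mSA).
Qed.

(** A shear acts on each vertical section by a translation. *)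
Lemma shearr_leb2 (phi : R -> R) : measurable_fun setT phi ->
  preserves_leb2 (fun p => (p.1, p.2 + phi p.1)).
Proof.
move=> mphi.
have mS : measurable_fun setT (fun p : RR => (p.1, p.2 + phi p.1) : RR).
  apply: measurable_fun_pair => //.
  apply: (@measurable_funD _ _ R setT snd (phi \o fst)) => //.
  by apply: measurableT_comp => //; exact: measurable_fst.
split => // A mA; rewrite /sigma_finite_prod /product_measure1.
apply: eq_integral => x _ /=.
rewrite (lebesgue_translation (phi x)); last exact: measurable_xsection.
by congr (leb _); apply/seteqP; split => y /=; rewrite /xsection/= !inE.
Qed.

(** Gives access to horizontal sections, on which the other kind of shear is a translation. *)
Lemma leb2E2 (A : set RR) : measurable A -> leb2 A = (leb \x^ leb)%E A.
Proof.
move=> mA; rewrite /sigma_finite_prod.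
by apply: product_measure_unique => // B D mB mD; exact: product_measure2E.
Qed.

Lemma shearl_leb2 (phi : R -> R) : measurable_fun setT phi ->
  preserves_leb2 (fun p => (p.1 + phi p.2, p.2)).
Proof.
move=> mphi.
have mS : measurable_fun setT (fun p : RR => (p.1 + phi p.2, p.2) : RR).
  apply: measurable_fun_pair => //.
  apply: (@measurable_funD _ _ R setT fst (phi \o snd)) => //.
  by apply: measurableT_comp => //; exact: measurable_snd.
split => // A mA; rewrite !leb2E2//; last first.
  by rewrite -[X in measurable X]setTI; exact: mS.
rewrite /product_measure2; apply: eq_integral => y _ /=.
rewrite (lebesgue_translation (phi y)); last exact: measurable_ysection.
by congr (leb _); apply/seteqP; split => x /=; rewrite /ysection/= !inE.
Qed.

Lemma translation_leb2 (a : R * R) : preserves_leb2 (fun p => (p.1 + a.1, p.2 + a.2)).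
Proof.
have := preserves_leb2_comp (@shearl_leb2 (cst a.1) (measurable_cst _))
  (@shearr_leb2 (cst a.2) (measurable_cst _)).
by [].
Qed.

(* A rotation of angle different from [pi] is a product of three shears. *)
Lemma rotation_leb2 (c s : R) : c ^+ 2 + s ^+ 2 = 1 ->
  preserves_leb2 (fun p => (c * p.1 - s * p.2, s * p.1 + c * p.2)).
Proof.
have gen c' s' : c' ^+ 2 + s' ^+ 2 = 1 -> 1 + c' != 0 ->
    preserves_leb2 (fun p => (c' * p.1 - s' * p.2, s' * p.1 + c' * p.2)).
  move=> cs c1; pose t := - s' / (1 + c').
  have mt (k : R) : measurable_fun setT (fun x : R => k * x) by exact: mulrl_measurable.
  have := preserves_leb2_comp (shearl_leb2 (mt t))
    (preserves_leb2_comp (shearr_leb2 (mt s')) (shearl_leb2 (mt t))).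
  congr preserves_leb2; apply/funext => -[x y] /=.
  have ts : t * s' = c' - 1.
    apply: (mulIf c1); rewrite /t mulrAC divfK//.
    by rewrite (_ : - s' * s' = c' ^+ 2 - (c' ^+ 2 + s' ^+ 2)); [rewrite cs|]; ring.
  have tc : t * (1 + c') = - s' by rewrite /t divfK.
  congr pair.
    transitivity ((1 + t * s') * x + (t * (1 + c') + t * (t * s' - (c' - 1))) * y);
      first by ring.
    by rewrite ts tc; ring.
  transitivity (s' * x + (1 + t * s') * y); first by ring.
  by rewrite ts; ring.
have [c1|] := eqVneq (1 + c) 0; last by move=> c1 cs; exact: gen.
move=> cs; have {c1} c1 : c = - 1 by apply/eqP; rewrite -addr_eq0 addrC c1.
have s0 : s = 0.
  by move: cs; rewrite c1 sqrrN expr1n => /(congr1 (fun x => x - 1)); rewrite addrC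
    addKr subrr => /eqP; rewrite sqrf_eq0 => /eqP.
(* The shear parameter - s / (1 + c) degenerates for the half turn, which is the square of this
   quarter turn. *)
have r01 : preserves_leb2 (fun p => (0 * p.1 - 1 * p.2, 1 * p.1 + 0 * p.2)).
  by apply: gen; rewrite ?addr0 ?oner_neq0// expr0n expr1n add0r.
have := preserves_leb2_comp r01 r01.
by congr preserves_leb2; apply/funext => -[x y] /=; rewrite c1 s0; congr pair; ring.
Qed.

Lemma rintble_gauss1 (e : R) : 0 < e -> rintble leb (fun x => expR (- e * x ^+ 2)).
Proof.
(* The normal density of variance 1/(2e) is a multiple of this Gaussian. *)
move=> e0; pose s := Num.sqrt (e^-1 / 2).
have s2 : s ^+ 2 = e^-1 / 2 by rewrite sqr_sqrtr// divr_ge0// invr_ge0 ltW.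
have s0 : s != 0 by rewrite -sqrf_eq0 s2 gt_eqF// divr_gt0// invr_gt0.
have := rintbleZ (normal_peak s)^-1 (integrable_normal_pdf 0 s).
congr (rintble _ _); apply/funext => x.
rewrite /normal_pdf (negbTE s0) mulrA mulVf ?mul1r; last first.
  by rewrite gt_eqF// normal_peak_gt0.
rewrite /normal_fun subr0 s2; congr expR.
by rewrite -mulr_natr divfK//; field; exact: lt0r_neq0.
Qed.

Definition toC (p : RR) : C := p.1 +i* p.2.

Lemma cabs_toC (p : RR) : cabs (toC p) ^+ 2 = p.1 ^+ 2 + p.2 ^+ 2.
Proof. by rewrite cabs_sqr. Qed.

Lemma cmeas_toC : cmeas toC.
Proof. by split; [exact: measurable_fst|exact: measurable_snd]. Qed.

Definition gauss2 (e : R) (p : RR) : R := expR (- e * cabs (toC p) ^+ 2).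

Lemma gauss2E e (p : RR) : gauss2 e p = expR (- e * p.1 ^+ 2) * expR (- e * p.2 ^+ 2).
Proof. by rewrite /gauss2 cabs_toC mulrDr expRD. Qed.

Lemma gauss2_ge0 e p : 0 <= gauss2 e p. Proof. exact: expR_ge0. Qed.

Lemma rintble_gauss2 e : 0 < e -> rintble leb2 (gauss2 e).
Proof.
move=> e0; rewrite (_ : gauss2 e = fun p => expR (- e * p.1 ^+ 2) * expR (- e * p.2
  ^+ 2)).
  have i1 := rintble_gauss1 e0.
  exact: (rintble_prod (fun=> expR_ge0 _) (fun=> expR_ge0 _) i1 i1).
by apply/funext => p; exact: gauss2E.
Qed.

Lemma measurable_gauss2 e : measurable_fun setT (gauss2 e).
Proof.
apply: measurableT_comp => //; apply: measurable_funM => //.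
rewrite [X in measurable_fun _ X](_ : _ = fun p : RR => p.1 ^+ 2 + p.2 ^+ 2).
  by apply: measurable_funD; apply: (@measurable_funX _ _ R); [exact:
    measurable_fst|exact: measurable_snd].
by apply/funext => p; exact: cabs_toC.
Qed.

Lemma Rintegral_gauss2 : \int[leb2]_p gauss2 1 p = pi.
Proof.
have i1 := rintble_gauss1 (ltr01 : 0 < 1 :> R).
have [||-> _] := @Rintegral_fubini _ _ _ _ R leb leb (gauss2 1) (rintble_gauss2 ltr01).
- by move=> x; under [X in rintble _ X]funext do rewrite gauss2E/=; exact: rintbleZ.
- by move=> y; under [X in rintble _ X]funext do rewrite gauss2E mulrC/=; exact:
  rintbleZ.
have I : \int[leb]_x expR (- 1 * x ^+ 2) = Num.sqrt pi :> R.
  rewrite /Rintegral -[RHS]/(fine (Num.sqrt pi)%:E) -integralT_gauss; congr fine.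
  by apply: eq_integral => x _; rewrite mulN1r.
under eq_Rintegral => x _.
  under eq_Rintegral do rewrite gauss2E/=.
  rewrite RintegralZl// I mulrC.
  over.
by rewrite RintegralZl// I -expr2 sqr_sqrtr// pi_ge0.
Qed.

Lemma cmeas_dyavg d (T : measurableType d) N (G : R -> T -> C) : (forall t, cmeas (G
  t)) ->
  cmeas (fun p => dyavg N (fun t => G t p)).
Proof.
elim: N G => [|N IH] G mG /=; first exact: mG.
apply: cmeasM; last exact: cmeas_cst.
by apply: cmeasD; apply: IH.
Qed.

Lemma cint_dyavg d (T : measurableType d) (mu : {measure set T -> \bar R}) N (G : R
  -> T -> C) :
  (forall t, cintble mu (G t)) -> cintble mu (fun p => dyavg N (fun t => G t p)) /\
  cint mu (fun p => dyavg N (fun t => G t p)) = dyavg N (fun t => cint mu (G t)).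
Proof.
elim: N G => [|N IH] G iG /=; first by split.
have [i1 e1] := IH (fun t => G (t / 2)) (fun t => iG _).
have [i2 e2] := IH (fun t => G ((1 + t) / 2)) (fun t => iG _).
under eq_cint do rewrite mulrC.
under [X in cintble _ X]funext do rewrite mulrC.
split; first by apply: cintbleZ; exact: cintbleD.
by rewrite cintZ ?cintD ?e1 ?e2 1?mulrC//; exact: cintbleD.
Qed.

(** By rotation invariance of the Gaussian, [h] may be replaced by its averages over dyadic
    rotations. These tend pointwise to [h 0] by [circle_mean], under the common bound M e^(-(1 - c)
    |w|^2). *)
Lemma gauss_mean (h : C -> C) (M c : R) : (forall z, cdiff h z) ->
  cmeas (h \o toC : RR -> C) -> c < 1 ->
  (forall w, cabs (h w) <= M * expR (c * cabs w ^+ 2)) ->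
  cint leb2 (fun p => h (toC p) * (gauss2 1 p)%:C) = pi%:C * h 0.
Proof.
move=> dh mh c1 hM; set I := cint _ _.
pose u (t : R) : C := cexp (t%:C * (0 +i* (pi *+ 2))).
have u1 t : cabs (u t) = 1.
  by rewrite cabs_cexp/= mulr0 mul0r subr0 expR0.
pose rot t (p : RR) : RR := (complex.Re (u t) * p.1 - complex.Im (u t) * p.2,
  complex.Im (u t) * p.1 + complex.Re (u t) * p.2).
have rotE t p : toC (rot t p) = toC p * u t.
  have E (a b x y : R) : (a * x - b * y) +i* (b * x + a * y) = (x +i* y) * (a +i* b).
    by simpc; congr (_ +i* _); ring.
  apply: (etrans (E (complex.Re (u t)) (complex.Im (u t)) p.1 p.2)).
  by congr (_ * _); case: (u t).
have rotP t : preserves_leb2 (rot t).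
  by apply: rotation_leb2; rewrite -cabs_sqr u1 expr1n.
have g0 : 0 < 1 - c by rewrite subr_gt0.
pose G t (p : RR) := h (toC p * u t) * (gauss2 1 p)%:C.
have mGG : cmeas (fun p => h (toC p) * (gauss2 1 p)%:C).
  by apply: cmeasM => //; apply: cmeas_real; exact: measurable_gauss2.
have GE t : G t = (fun p => h (toC p) * (gauss2 1 p)%:C) \o rot t.
  by apply/funext => p; rewrite /G /gauss2/= !rotE cabsM u1 mulr1.
have mG t : cmeas (G t) by rewrite GE; apply: cmeas_comp => //; exact: (rotP t).1.
have bG t p : cabs (G t p) <= M * gauss2 (1 - c) p.
  rewrite /G cabsM cabs_real ger0_norm ?gauss2_ge0//.
  have := hM (toC p * u t); rewrite cabsM u1 mulr1 => H.
  have -> : gauss2 (1 - c) p = expR (c * cabs (toC p) ^+ 2) * gauss2 1 p.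
    by rewrite /gauss2 -expRD; congr expR; ring.
  by rewrite mulrA ler_wpM2r ?gauss2_ge0.
have iM : rintble leb2 (fun p => M * gauss2 (1 - c) p).
  by apply: rintbleZ; exact: rintble_gauss2.
have iG t : cintble leb2 (G t) by exact: (cintble_le (mG t) (bG t) iM).
have GI t : cint leb2 (G t) = I.
  rewrite /I GE; apply/esym/(cint_push (rotP t).1 (rotP t).2 mGG); rewrite -GE.
  exact: iG.
have igC : cintble leb2 (fun p => (gauss2 1 p)%:C).
  apply: (@cintble_le _ _ _ _ _ (gauss2 1)).
  - by apply: cmeas_real; exact: measurable_gauss2.
  - by move=> p; rewrite cabs_real ger0_norm ?gauss2_ge0.
  - exact: rintble_gauss2.
have -> : pi%:C * h 0 = cint leb2 (fun p => h 0 * (gauss2 1 p)%:C).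
  rewrite cintZ// mulrC; congr (_ * _); rewrite /cint/= Rintegral_gauss2.
  by rewrite Rintegral_cst// mul0r.
symmetry; apply: (@cint_dominated _ _ _ leb2 (fun N p => dyavg N (fun t => G t p)) _
  _ _ _ _ _ iM).
- by move=> N; exact: cmeas_dyavg.
- apply: cmeasM; first exact: cmeas_cst.
  by apply: cmeas_real; exact: measurable_gauss2.
- by move=> N p; apply: dyavg_le => t _.
- move=> p e e0.
  have e'0 : 0 < e / (gauss2 1 p) by rewrite divr_gt0// expR_gt0.
  have [N0 hN0] := circle_mean (toC p) dh e'0.
  exists N0 => N /hN0; rewrite ler_pdivlMr ?expR_gt0// => H.
  rewrite [X in cabs (X - _)](_ : _ = (gauss2 1 p)%:C * dyavg N (fun t => h (toC p *
    u t))).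
    rewrite [h 0 * _]mulrC -mulrBr cabsM cabs_real ger0_norm ?gauss2_ge0//.
    by rewrite mulrC.
  by rewrite -dyavgZ; apply: eq_dyavg => t _; rewrite mulrC.
- by move=> N; have [_ ->] := cint_dyavg N iG; rewrite -[RHS](dyavg_cst N); apply:
  eq_dyavg.
Qed.

(** The translation by z turns the exponent z conj(w) - |w|^2 into - conj(z) w - |w|^2. The kernel
    thus becomes a holomorphic factor, and [gauss_mean] applies to h(z + w) e^(- conj(z) w), whose
    value at 0 is h(z). *)
Lemma gauss_reproducing1 (h : C -> C) (M c : R) (z : C) : (forall z, cdiff h z) ->
  cmeas (h \o toC : RR -> C) -> 0 <= c < 1 ->
  (forall w, cabs (h w) <= M * expR (c * cabs w ^+ 2)) ->
  cint leb2 (fun p => h (toC p) * cexp (z * conjc (toC p)) * (gauss2 1 p)%:C) = pi%:C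
    * h z.
Proof.
move=> dh mh /andP[c0 c1] hM.
have M0 : 0 <= M.
  by have := hM 0; rewrite cabs0 expr0n mulr0 expR0 mulr1; apply: le_trans; exact:
    cabs_ge0.
pose k w := h (z + w) * cexp (- conjc z * w).
pose tau (p : RR) : RR := (p.1 + complex.Re z, p.2 + complex.Im z).
have tauP : preserves_leb2 tau := translation_leb2 (complex.Re z, complex.Im z).
have tauE p : toC (tau p) = z + toC p.
  by case: z @tau {k tauP} => a b; rewrite /toC/=; congr (_ +i* _); rewrite addrC.
have dk w : cdiff k w.
  apply: cdiffM.
    apply: (@cdiff_comp _ h (fun w => z + w)) => //.
    by apply: cdiffD; [exact: cdiff_cst|exact: cdiff_id].
  apply: (@cdiff_comp _ (@cexp R) (fun w => - conjc z * w)); last exact: cdiff_cexp.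
  by apply: cdiffM; [exact: cdiff_cst|exact: cdiff_id].
have mk : cmeas (k \o toC : RR -> C).
  apply: cmeasM; last first.
    by apply: cmeas_cexp; apply: cmeasM; [exact: cmeas_cst|exact: cmeas_toC].
  have := cmeas_comp mh tauP.1; congr cmeas.
  by apply/funext => p /=; rewrite tauE.
pose e := (1 - c) / 2; have e0 : 0 < e by rewrite divr_gt0// subr_gt0.
(* The cross terms sum to at most (2c + 1) |z| |w| <= 3 |z| |w| <= e |w|^2 + 9/(4e) |z|^2. *)
have kM w : cabs (k w) <= M * expR ((c + 9 / 4 / e) * cabs z ^+ 2) * expR ((c + e) *
  cabs w ^+ 2).
  rewrite /k cabsM cabs_cexp (le_trans (ler_wpM2r (expR_ge0 _) (hM _)))//.
  rewrite -[leLHS]mulrA -[leRHS]mulrA ler_wpM2l// -!expRD ler_expR.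
  have H1 : complex.Re (- conjc z * w) <= cabs z * cabs w.
    by rewrite (le_trans (ler_norm _))// (le_trans (cabs_Re _))// cabsM cabsN cabs_conj.
  have H2 : cabs (z + w) ^+ 2 <= (cabs z + cabs w) ^+ 2.
    by rewrite ler_sqr ?nnegrE ?addr_ge0 ?cabs_ge0// cabsD.
  have zg := cabs_ge0 z; have wg := cabs_ge0 w.
  have H3 : c * cabs (z + w) ^+ 2 <= c * (cabs z + cabs w) ^+ 2 by rewrite ler_wpM2l.
  have H4 : 0 <= e * (cabs w - 3 / 2 / e * cabs z) ^+ 2 by rewrite mulr_ge0
    ?sqr_ge0// ltW.
  have H4' : e * (cabs w - 3 / 2 / e * cabs z) ^+ 2 =
    e * cabs w ^+ 2 - 3 * (cabs z * cabs w) + 9 / 4 / e * cabs z ^+ 2.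
    by field; exact: lt0r_neq0.
  have H5 : c * (cabs z * cabs w) <= cabs z * cabs w by rewrite ler_piMl ?mulr_ge0//
    ltW.
  have -> : (c + 9 / 4 / e) * cabs z ^+ 2 + (c + e) * cabs w ^+ 2 =
    c * cabs z ^+ 2 + 9 / 4 / e * cabs z ^+ 2 + c * cabs w ^+ 2 + e * cabs w ^+ 2 by
      ring.
  have H6 : c * (cabs z + cabs w) ^+ 2 =
    c * cabs z ^+ 2 + 2 * (c * (cabs z * cabs w)) + c * cabs w ^+ 2 by ring.
  by lra.
have ce1 : c + e < 1 by rewrite /e; lra.
have -> : h z = k 0 by rewrite /k addr0 mulr0 cexp0 mulr1.
rewrite -(gauss_mean dk mk ce1 kM).
have mF : cmeas (fun p => h (toC p) * cexp (z * conjc (toC p)) * (gauss2 1 p)%:C).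
  apply: cmeasM; last by apply: cmeas_real; exact: measurable_gauss2.
  apply: cmeasM => //; apply: cmeas_cexp; apply: cmeasM; first exact: cmeas_cst.
  by apply: cmeas_conj; exact: cmeas_toC.
have FE : (fun p => h (toC p) * cexp (z * conjc (toC p)) * (gauss2 1 p)%:C) \o tau =
    fun p => k (toC p) * (gauss2 1 p)%:C.
  apply/funext => p; rewrite /comp /k /gauss2 tauE -!mulrA; congr (_ * _).
  rewrite !gaussCE -!cexpD; congr cexp; move: (toC p) => w.
  by rewrite !rmorphD/=; ring.
have iF : cintble leb2 ((fun p => h (toC p) * cexp (z * conjc (toC p)) * (gauss2 1
  p)%:C) \o tau).
  rewrite FE; apply: (cintble_le (g := fun p => M * expR ((c + 9 / 4 / e) * cabs z ^+
    2) * gauss2 (1 - (c + e)) p)).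
  - by apply: cmeasM => //; apply: cmeas_real; exact: measurable_gauss2.
  - move=> p; rewrite cabsM cabs_real ger0_norm ?gauss2_ge0//.
    have -> : gauss2 (1 - (c + e)) p = expR ((c + e) * cabs (toC p) ^+ 2) * gauss2 1 p.
      by rewrite /gauss2 -expRD; congr expR; ring.
    by rewrite mulrA ler_wpM2r ?gauss2_ge0.
  - by apply: rintbleZ; apply: rintble_gauss2; rewrite subr_gt0.
by rewrite (cint_push tauP.1 tauP.2 mF iF) FE.
Qed.

End plane.

(** * The reproducing property in several variables *)
Section rows.
Context {R : realType}.
Local Notation C := R[i].
Implicit Types (n : nat).

Definition consrow n (a : C) (v : 'rV[C]_n) : 'rV[C]_n.+1 :=
  \row_i oapp (fun j => v 0 j) a (unlift ord0 i).

Definition tailrow n (z : 'rV[C]_n.+1) : 'rV[C]_n := \row_j z 0 (lift ord0 j).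

Lemma consrow_eta n (z : 'rV[C]_n.+1) : consrow (z 0 ord0) (tailrow z) = z.
Proof. by apply/rowP => i; rewrite !mxE; case: unliftP => [j ->|->] //=; rewrite mxE.
  Qed.

Lemma consrow0 n a (v : 'rV[C]_n) : consrow a v 0 ord0 = a.
Proof. by rewrite mxE unlift_none. Qed.

Lemma consrowS n a (v : 'rV[C]_n) j : consrow a v 0 (lift ord0 j) = v 0 j.
Proof. by rewrite mxE liftK. Qed.

Lemma consrowD n a b (v w : 'rV[C]_n) : consrow a v + consrow b w = consrow (a + b)
  (v + w).
Proof. by apply/rowP => i; rewrite !mxE; case: unliftP => [j _|_] //=; rewrite mxE. Qed.

Lemma consrowZ n c a (v : 'rV[C]_n) : c *: consrow a v = consrow (c * a) (c *: v).
Proof. by apply/rowP => i; rewrite !mxE; case: unliftP => [j _|_] //=; rewrite mxE. Qed.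

Lemma cdot_cons n a b (v w : 'rV[C]_n) :
  cdot (consrow a v) (cconj (consrow b w)) = a * conjc b + cdot v (cconj w).
Proof.
rewrite /cdot big_ord_recl consrow0 !mxE unlift_none/=; congr (_ + _).
by apply: eq_bigr => j _; rewrite consrowS !mxE liftK.
Qed.

Lemma norm2E n (v : 'rV[C]_n) : norm2 v = \sum_(k < n) cabs (v 0 k) ^+ 2.
Proof.
rewrite /norm2 /cdot; elim/big_rec2: _ => // k x y _ <-.
by rewrite ReD mxE -cabs2E.
Qed.

Lemma norm2_ge0 n (v : 'rV[C]_n) : 0 <= norm2 v.
Proof. by rewrite norm2E sumr_ge0// => k _; rewrite sqr_ge0. Qed.

Lemma norm2_cons n a (v : 'rV[C]_n) : norm2 (consrow a v) = cabs a ^+ 2 + norm2 v.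
Proof.
by rewrite !norm2E big_ord_recl consrow0; congr (_ + _); apply: eq_bigr => j _;
  rewrite consrowS.
Qed.

Lemma norm2Z n c (v : 'rV[C]_n) : norm2 (c *: v) = cabs c ^+ 2 * norm2 v.
Proof.
by rewrite !norm2E mulr_sumr; apply: eq_bigr => k _; rewrite mxE cabsM exprMn.
Qed.

Lemma norm2D n (v w : 'rV[C]_n) : norm2 (v + w) <= 2 * norm2 v + 2 * norm2 w.
Proof.
rewrite !norm2E !mulr_sumr -big_split; apply: ler_sum => k _; rewrite mxE.
have H : cabs (v 0 k + w 0 k) ^+ 2 <= (cabs (v 0 k) + cabs (w 0 k)) ^+ 2.
  by rewrite ler_sqr ?nnegrE ?addr_ge0 ?cabs_ge0// cabsD.
have := sqr_ge0 (cabs (v 0 k) - cabs (w 0 k)).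
by move: H; rewrite sqrrD sqrrB/=; lra.
Qed.

Lemma Re_cdot_le n (z w : 'rV[C]_n) e : 0 < e ->
  complex.Re (cdot z w) <= e * norm2 w + (4 * e)^-1 * norm2 z.
Proof.
move=> e0; rewrite !norm2E !mulr_sumr -big_split /cdot/=.
elim/big_ind2: _ => [|x1 x2 y1 y2 h1 h2|k _]; first by [].
  by rewrite ReD lerD.
rewrite (le_trans (ler_norm _))// (le_trans (cabs_Re _))// cabsM.
have H4 : 0 <= e * (cabs (w 0 k) - 2^-1 / e * cabs (z 0 k)) ^+ 2 by rewrite mulr_ge0
  ?sqr_ge0// ltW.
have H4' : e * (cabs (w 0 k) - 2^-1 / e * cabs (z 0 k)) ^+ 2 =
    e * cabs (w 0 k) ^+ 2 - (cabs (z 0 k) * cabs (w 0 k)) + (4 * e)^-1 * cabs (z 0 k)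
      ^+ 2.
  by field; exact: lt0r_neq0.
by lra.
Qed.

Lemma norm2_conj n (w : 'rV[C]_n) : norm2 (cconj w) = norm2 w.
Proof. by rewrite !norm2E; apply: eq_bigr => k _; rewrite mxE cabs_conj. Qed.

Lemma cconjK n (w : 'rV[C]_n) : cconj (cconj w) = w.
Proof. by apply/rowP => k; rewrite !mxE conjcK. Qed.

Lemma cdot_conj n (z w : 'rV[C]_n) : conjc (cdot z w) = cdot (cconj z) (cconj w).
Proof.
by rewrite /cdot rmorph_sum; apply: eq_bigr => k _; rewrite rmorphM/= !mxE.
Qed.

Lemma cdotC n (z w : 'rV[C]_n) : cdot z w = cdot w z.
Proof. by apply: eq_bigr => k _; rewrite mulrC. Qed.

Lemma cdotDl n (z z' w : 'rV[C]_n) : cdot (z + z') w = cdot z w + cdot z' w.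
Proof. by rewrite /cdot -big_split; apply: eq_bigr => k _; rewrite mxE mulrDl. Qed.

Lemma cdotDr n (z w w' : 'rV[C]_n) : cdot z (w + w') = cdot z w + cdot z w'.
Proof. by rewrite !(cdotC z) cdotDl. Qed.

Lemma cdotZl n c (z w : 'rV[C]_n) : cdot (c *: z) w = c * cdot z w.
Proof. by rewrite /cdot mulr_sumr; apply: eq_bigr => k _; rewrite mxE mulrA. Qed.

Lemma cdotNl n (z w : 'rV[C]_n) : cdot (- z) w = - cdot z w.
Proof. by rewrite -scaleN1r cdotZl mulN1r. Qed.

Lemma cdotNr n (z w : 'rV[C]_n) : cdot z (- w) = - cdot z w.
Proof. by rewrite cdotC cdotNl cdotC. Qed.

Lemma cconjD n (z w : 'rV[C]_n) : cconj (z + w) = cconj z + cconj w.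
Proof. by apply/rowP => k; rewrite !mxE rmorphD. Qed.

(** Holomorphy is recorded along complex lines: this is what the one-variable theorems consume, and
    it passes to slices with a fixed first coordinate, as the induction on n demands. *)
Definition line_holo n (F : 'rV[C]_n -> C) := forall z d w, cdiff (fun s => F (z + s
  *: d)) w.

End rows.

Section tuples.
Context {R : realType}.
Local Notation C := R[i].
Local Notation RR := (measurableTypeR R * measurableTypeR R)%type.
Local Notation leb := (@lebesgue_measure R).
Local Notation leb2 := (sigma_finite_prod leb leb).
Local Notation Ln n := (tuple_measure leb2 n).

Lemma cvec_cons n (p : RR) (t : n.-tuple RR) :
  cvec (cons_pt (p, t)) = consrow (toC p) (cvec t).
Proof.
apply/rowP => i; rewrite !mxE; case: unliftP => [j ->|->] /=; last by rewrite tnth0.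
by rewrite tnthS mxE.
Qed.

Lemma cmeas_cvec n k : cmeas (fun t : n.-tuple RR => cvec t 0 k).
Proof.
have := cmeas_comp (@cmeas_toC R) (@measurable_tnth _ _ n k).
by congr cmeas; apply/funext => t; rewrite mxE.
Qed.

Definition uncvec n (v : 'rV[C]_n) : n.-tuple RR :=
  [tuple (complex.Re (v 0 i), complex.Im (v 0 i)) | i < n].

Lemma uncvecK n (v : 'rV[C]_n) : cvec (uncvec v) = v.
Proof. by apply/rowP => i; rewrite mxE tnth_mktuple; case: (v 0 i). Qed.

Lemma cmeas_cdot d (T : measurableType d) n (u v : T -> 'rV[C]_n) :
  (forall k, cmeas (fun x => u x 0 k)) -> (forall k, cmeas (fun x => v x 0 k)) ->
  cmeas (fun x => cdot (u x) (v x)).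
Proof. by move=> mu mv; apply: cmeas_sum => k; exact: cmeasM. Qed.

Lemma cmeas_cconj d (T : measurableType d) n (u : T -> 'rV[C]_n) :
  (forall k, cmeas (fun x => u x 0 k)) -> forall k, cmeas (fun x => cconj (u x) 0 k).
Proof.
by move=> mu k; under [X in cmeas X]funext do rewrite mxE; exact: cmeas_conj.
Qed.

Definition gaussn n (e : R) (v : 'rV[C]_n) : R := expR (- e * norm2 v).

Lemma gaussn_ge0 n e (v : 'rV[C]_n) : 0 <= gaussn e v. Proof. exact: expR_ge0. Qed.

Lemma gaussn_cons n e (p : RR) (t : n.-tuple RR) :
  gaussn e (cvec (cons_pt (p, t))) = gauss2 e p * gaussn e (cvec t).
Proof. by rewrite /gaussn /gauss2 cvec_cons norm2_cons mulrDr expRD. Qed.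

Lemma measurable_gaussn d (T : measurableType d) n e (u : T -> 'rV[C]_n) :
  (forall k, cmeas (fun x => u x 0 k)) -> measurable_fun setT (fun x => gaussn e (u x)).
Proof.
move=> mu; apply: (measurableT_comp (@measurable_expR R)).
apply: measurable_funM => //.
by have [] := cmeas_cdot mu (cmeas_cconj mu).
Qed.

Lemma rintble_gaussn n e : 0 < e -> rintble (Ln n) (fun t => gaussn e (cvec t)).
Proof.
move=> e0; elim: n => [|n IH].
  apply: (@rintble_le _ _ _ _ _ (cst 1)).
  - by apply: measurable_gaussn; exact: cmeas_cvec.
  - by move=> t; rewrite ger0_norm ?gaussn_ge0// expR_le1 mulNr oppr_le0 mulr_ge0
    ?norm2_ge0// ltW.
  - exact: finite_measure_integrable_cst.
apply: (rintble_push (m1 := sigma_finite_prod leb2 (Ln n)) (m2 := Ln n.+1)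
  (@measurable_cons_pt _ _ n) (fun _ _ => erefl)).
- by apply: measurable_gaussn; exact: cmeas_cvec.
- have := rintble_prod (@gauss2_ge0 R e) (fun t => gaussn_ge0 e (cvec t))
  (rintble_gauss2 e0) IH.
  by congr (rintble _ _); apply/funext => -[p t]; rewrite /= -gaussn_cons.
Qed.

Lemma cabs_cexp_cdot n (z w : 'rV[C]_n) e : 0 < e ->
  cabs (cexp (cdot z (cconj w))) <= expR ((4 * e)^-1 * norm2 z) * expR (e * norm2 w).
Proof.
move=> e0; rewrite cabs_cexp -expRD ler_expR addrC -[in norm2 w]norm2_conj.
exact: Re_cdot_le.
Qed.

(** Induction on n by Fubini's theorem: the inner integral is the induction hypothesis for a slice
    of [F], whose bound keeps the exponent [c] and changes only [M]; the first coordinate is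
    [gauss_reproducing1]. *)
Lemma gauss_reproducing n (F : 'rV[C]_n -> C) (M c : R) (z : 'rV[C]_n) :
  line_holo F -> cmeas (fun t => F (cvec t)) -> 0 <= c < 1 ->
  (forall w, cabs (F w) <= M * expR (c * norm2 w)) ->
  cint (Ln n) (fun t => F (cvec t) * cexp (cdot z (cconj (cvec t))) * (gaussn 1 (cvec
    t))%:C) =
  (pi ^+ n)%:C * F z.
Proof.
elim: n => [|n IH] in F M c z * => hF mF /andP[c0 c1] FM.
  pose G (t : 0.-tuple RR) : C := F (cvec t) * cexp (cdot z (cconj (cvec t))) *
    (gaussn 1 (cvec t))%:C.
  rewrite -[LHS]/(cint _ G) (_ : G = fun=> F z).
    rewrite /cint !Rintegral_cst//= indicT !mulr1 mul1r.
    by case: (F z).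
  apply/funext => t; rewrite /G /gaussn norm2E /cdot !big_ord0 mulr0 expR0 cexp0 !mulr1.
  by congr F; apply/rowP => -[].
pose G (t : n.+1.-tuple RR) : C :=
  F (cvec t) * cexp (cdot z (cconj (cvec t))) * (gaussn 1 (cvec t))%:C.
rewrite -[LHS]/(cint _ G).
have M0 : 0 <= M.
  have := FM 0; rewrite (_ : norm2 0 = 0) ?mulr0 ?expR0 ?mulr1.
    by apply: le_trans; exact: cabs_ge0.
  by rewrite norm2E big1// => k _; rewrite mxE cabs0 expr0n.
have mcv k : cmeas (fun t : n.+1.-tuple RR => cvec t 0 k) by exact: cmeas_cvec.
have mG : cmeas G.
  apply: cmeasM; last by apply: cmeas_real; exact: measurable_gaussn.
  apply: cmeasM => //; apply: cmeas_cexp; apply: cmeas_cdot => [k|]; first exact: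
    cmeas_cst.
  exact: cmeas_cconj.
(* As c + 2 e = 1, one e absorbs the kernel and the other leaves an integrable Gaussian. *)
pose e := (1 - c) / 2; have e0 : 0 < e by rewrite divr_gt0// subr_gt0.
pose K := M * expR ((4 * e)^-1 * norm2 z).
have K0 : 0 <= K by rewrite mulr_ge0// expR_ge0.
have GK t : cabs (G t) <= K * gaussn e (cvec t).
  rewrite /G !cabsM cabs_real ger0_norm ?gaussn_ge0//.
  have -> : gaussn e (cvec t) = expR (c * norm2 (cvec t)) * expR (e * norm2 (cvec t))
    * gaussn 1 (cvec t).
    by rewrite /gaussn -!expRD; congr expR; rewrite /e; field.
  rewrite mulrA ler_wpM2r ?gaussn_ge0//.
  rewrite (_ : K * _ = M * expR (c * norm2 (cvec t)) * (expR ((4 * e)^-1 * norm2 z) *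
    expR (e * norm2 (cvec t)))).
    by apply: ler_pM; rewrite ?cabs_ge0 ?cabs_cexp_cdot.
  by rewrite /K; ring.
have mGc : cmeas (G \o @cons_pt _ _ n) := cmeas_comp mG (@measurable_cons_pt _ _ n).
have Gb p t : cabs ((G \o @cons_pt _ _ n) (p, t)) <= K * gauss2 e p * gaussn e (cvec t).
  by rewrite /= (le_trans (GK _))// gaussn_cons mulrA.
have ia := rintbleZ K (rintble_gauss2 e0).
have ib := rintble_gaussn n e0.
have a0 p : 0 <= K * gauss2 e p by rewrite mulr_ge0 ?gauss2_ge0.
have b0 t := gaussn_ge0 e (@cvec R n t).
have iG := cintble_fubini mGc Gb ia ib a0 b0.
rewrite (cint_push (m1 := sigma_finite_prod leb2 (Ln n)) (m2 := Ln n.+1)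
  (@measurable_cons_pt _ _ n) (fun _ _ => erefl) mG iG).
have [-> _] := cint_fubini mGc Gb ia ib a0 b0.
have zE := consrow_eta z; set z0 := z 0 ord0 in zE; set z' := tailrow z in zE.
have hline p : line_holo (fun v => F (consrow p v)).
  move=> v d w; have := hF (consrow p v) (consrow 0 d) w; congr (cdiff _ _).
  by apply/funext => s; rewrite consrowZ mulr0 consrowD addr0.
have mcons (p : RR) : measurable_fun setT (fun t : n.-tuple RR => cons_pt (p, t)).
  by apply: (measurableT_comp (@measurable_cons_pt _ _ n)); exact: measurable_pair1.
have mcons' (t : n.-tuple RR) : measurable_fun setT (fun p : RR => cons_pt (p, t)).
  by apply: (measurableT_comp (@measurable_cons_pt _ _ n)); exact: measurable_pair2.
have inner (p : RR) : cint (Ln n) (fun t => (G \o @cons_pt _ _ n) (p, t)) =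
    (pi ^+ n)%:C * (F (consrow (toC p) z') * cexp (z0 * conjc (toC p)) * (gauss2 1
      p)%:C).
  have GE : (fun t => (G \o @cons_pt _ _ n) (p, t)) = fun t =>
      cexp (z0 * conjc (toC p)) * (gauss2 1 p)%:C *
      (F (consrow (toC p) (cvec t)) * cexp (cdot z' (cconj (cvec t))) * (gaussn 1
        (cvec t))%:C).
    apply/funext => t; rewrite /comp /G gaussn_cons cvec_cons -{1}zE cdot_cons cexpD
      rmorphM/=.
    by ring.
  have := cintble_le (cmeas_comp mGc (measurable_pair1 p)) (Gb p) (rintbleZ (K *
    gauss2 e p) ib).
  rewrite /comp -[(fun x => _)]/(fun t => (G \o @cons_pt _ _ n) (p, t)) GE => ip.
  (* Dividing by this factor recovers the integrability of the slice from that of [G]. *)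
  have k0 : cexp (z0 * conjc (toC p)) * (gauss2 1 p)%:C != 0.
    by rewrite mulf_neq0 ?cexp_neq0// -cabs_gt0 cabs_real normr_gt0 gt_eqF// expR_gt0.
  have {}ip := cintbleZ (cexp (z0 * conjc (toC p)) * (gauss2 1 p)%:C)^-1 ip.
  rewrite cintZ; last first.
    by move: ip; congr (cintble _ _); apply/funext => t; rewrite mulKf.
  rewrite (IH (fun v => F (consrow (toC p) v)) (M * expR (c * cabs (toC p) ^+ 2)) c
    z' (hline _)).
  - by ring.
  - by have := cmeas_comp mF (mcons p); congr cmeas; apply/funext => t; rewrite /comp
    cvec_cons.
  - by rewrite c0.
  - by move=> w; rewrite (le_trans (FM _))// norm2_cons mulrDr expRD mulrA.
under eq_cint do rewrite inner.
have hh w : cdiff (fun a => F (consrow a z')) w.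
  have := hF (consrow 0 z') (consrow 1 0) w; congr (cdiff _ _).
  by apply/funext => s; rewrite consrowZ mulr1 scaler0 consrowD add0r addr0.
have mh : cmeas ((fun a => F (consrow a z')) \o toC).
  have := cmeas_comp mF (mcons' (uncvec z')); congr cmeas.
  by apply/funext => p; rewrite /comp cvec_cons uncvecK.
have hb w : cabs (F (consrow w z')) <= M * expR (c * norm2 z') * expR (c * cabs w ^+ 2).
  by rewrite (le_trans (FM _))// norm2_cons mulrDr expRD [expR (c * _) * _]mulrC mulrA.
have c01 : 0 <= c < 1 by rewrite c0.
rewrite cintZ ?(gauss_reproducing1 z0 hh mh c01 hb) ?zE; first by rewrite exprS
  rmorphM/=; ring.
apply: (cintble_le (g := fun p => M * expR (c * norm2 z') * expR ((4 * e)^-1 * cabs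
  z0 ^+ 2) * gauss2 e p)).
- apply: cmeasM; last by apply: cmeas_real; exact: measurable_gauss2.
  apply: cmeasM; first exact: mh.
  apply: cmeas_cexp; apply: cmeasM; first exact: cmeas_cst.
  by apply: cmeas_conj; exact: cmeas_toC.
- move=> p; rewrite !cabsM cabs_real ger0_norm ?gauss2_ge0//.
  have -> : gauss2 e p = expR (c * cabs (toC p) ^+ 2) * expR (e * cabs (toC p) ^+ 2)
    * gauss2 1 p.
    by rewrite /gauss2 -!expRD; congr expR; rewrite /e; field.
  rewrite mulrA ler_wpM2r ?gauss2_ge0//.
  rewrite (_ : _ * _ * (_ * _) = M * expR (c * norm2 z') * expR (c * cabs (toC p) ^+
    2) *
    (expR ((4 * e)^-1 * cabs z0 ^+ 2) * expR (e * cabs (toC p) ^+ 2))); last by ring.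
  apply: ler_pM; rewrite ?cabs_ge0//.
  (* The scalar estimate is the case of vectors with an empty tail. *)
  have := cabs_cexp_cdot (consrow z0 (0 : 'rV_0)) (consrow (toC p) (0 : 'rV_0)) e0.
  by rewrite cdot_cons !norm2_cons !norm2E /cdot !big_ord0 !addr0.
- by apply: rintbleZ; exact: rintble_gauss2.
Qed.

End tuples.

(** * Gaussian integrals of functions of order 2 and type 0 *)

Section tame.
Context {R : realType} {n : nat}.
Local Notation C := R[i].
Local Notation Cn := 'rV[C]_n.
Local Notation RR := (measurableTypeR R * measurableTypeR R)%type.
Local Notation leb2 := (sigma_finite_prod (@lebesgue_measure R) (@lebesgue_measure R)).
Local Notation Ln := (tuple_measure leb2 n).
Implicit Types (F G : Cn -> C) (z w a b : Cn).

Lemma cmeas_row d (T : measurableType d) F (u : T -> Cn) :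
  cmeas (fun t => F (cvec t)) -> (forall k, cmeas (fun x => u x 0 k)) ->
  cmeas (fun x => F (u x)).
Proof.
move=> mF mu.
have mt : measurable_fun setT (fun x => uncvec (u x) : n.-tuple RR).
  apply/measurable_fun_tnthP => k.
  rewrite [X in measurable_fun _ X](_ : _ = fun x =>
      (complex.Re (u x 0 k), complex.Im (u x 0 k)) : RR).
    by apply: measurable_fun_pair; [exact: (mu k).1|exact: (mu k).2].
  by apply/funext => x; rewrite /= tnth_mktuple.
have := cmeas_comp mF mt; congr cmeas.
by apply/funext => x; rewrite /= uncvecK.
Qed.

Lemma cmeas_cvecP F : cmeas (fun t => F (cvec t)) -> cmeas F.
Proof.
by move=> [F1 F2]; split => _ A mA;
  rewrite setTI; [have := F1 measurableT A mA|have := F2 measurableT A mA]; rewrite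
    setTI.
Qed.

(** Order 2 and type 0, with a bound at every point. Since c is arbitrarily small, the class is
    stable under products, translations and factors e^(w . a), and all its members are integrable
    against the Gaussian. *)
Definition tame F := cmeas (fun t => F (cvec t)) /\
  forall c, 0 < c -> exists M, forall w, cabs (F w) <= M * expR (c * norm2 w).

Definition slow F := line_holo F /\ tame F.

Lemma tameM F G : tame F -> tame G -> tame (fun w => F w * G w).
Proof.
move=> [mF bF] [mG bG]; split; first exact: cmeasM.
move=> c c0; have c20 : 0 < c / 2 by rewrite divr_gt0.
have [M1 h1] := bF _ c20; have [M2 h2] := bG _ c20.
exists (M1 * M2) => w; rewrite cabsM.
rewrite (_ : c * _ = c / 2 * norm2 w + c / 2 * norm2 w); last by field.
by rewrite expRD mulrACA ler_pM ?cabs_ge0.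
Qed.

Lemma tameD F G : tame F -> tame G -> tame (fun w => F w + G w).
Proof.
move=> [mF bF] [mG bG]; split; first exact: cmeasD.
move=> c c0; have [M1 h1] := bF _ c0; have [M2 h2] := bG _ c0.
by exists (M1 + M2) => w; rewrite (le_trans (cabsD _ _))// mulrDl lerD.
Qed.

Lemma tame_cst (k : C) : tame (fun=> k).
Proof.
split; first exact: cmeas_cst.
move=> c c0; exists (cabs k) => w.
rewrite ler_peMr ?cabs_ge0// (le_trans _ (expR_ge1Dx _))// lerDl.
by rewrite mulr_ge0 ?norm2_ge0// ltW.
Qed.

Lemma tame_conj F : tame F -> tame (fun w => conjc (F w)).
Proof.
move=> [mF bF]; split; first exact: cmeas_conj.
by move=> c /bF[M hM]; exists M => w; rewrite cabs_conj.
Qed.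

Lemma tame_cexp a : tame (fun w => cexp (cdot w a)).
Proof.
split.
  by apply: cmeas_cexp; apply: cmeas_cdot => k; [exact: cmeas_cvec|exact: cmeas_cst].
move=> c c0; exists (expR ((4 * c)^-1 * norm2 a)) => w.
rewrite cabs_cexp -expRD ler_expR addrC cdotC; exact: Re_cdot_le.
Qed.

Lemma tame_cexp_conj a : tame (fun w => cexp (cdot a (cconj w))).
Proof.
have := tame_conj (tame_cexp (cconj a)); congr tame.
by apply/funext => w; rewrite cexp_conj cdot_conj cconjK cdotC.
Qed.

Lemma tame_shift F z : tame F -> tame (fun w => F (z + w)).
Proof.
move=> [mF bF]; split.
  apply: (cmeas_row mF) => k.
  under [X in cmeas X]funext do rewrite mxE.
  by apply: cmeasD; [exact: cmeas_cst|exact: cmeas_cvec].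
move=> c c0; have c20 : 0 < c / 2 by rewrite divr_gt0.
have [M hM] := bF _ c20; exists (M * expR (c * norm2 z)) => w.
have M0 : 0 <= M.
  have := le_trans (cabs_ge0 _) (hM 0); by rewrite pmulr_lge0// expR_gt0.
rewrite (le_trans (hM _))// -[leRHS]mulrA ler_wpM2l// -expRD ler_expR.
have := norm2D z w => /(ler_wpM2l (ltW c20)); lra.
Qed.

Lemma slow_tame F : slow F -> tame F. Proof. by case. Qed.

Lemma slowM F G : slow F -> slow G -> slow (fun w => F w * G w).
Proof.
move=> [hF tF] [hG tG]; split; last exact: tameM.
by move=> z d w; exact: cdiffM.
Qed.

Lemma slow_cexp a : slow (fun w => cexp (cdot w a)).
Proof.
split; last exact: tame_cexp.
move=> z d w; apply: (@cdiff_comp _ (@cexp R) (fun s => cdot (z + s *: d) a)).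
  under [X in cdiff X _]funext do rewrite cdotDl cdotZl.
  by apply: cdiffD; [exact: cdiff_cst|apply: cdiffM; [exact: cdiff_id|exact:
    cdiff_cst]].
exact: cdiff_cexp.
Qed.

Lemma slow_shift F z : slow F -> slow (fun w => F (z + w)).
Proof.
move=> [hF tF]; split; last exact: tame_shift.
move=> z' d w; have := hF (z + z') d w; congr (cdiff _ _).
by apply/funext => s; rewrite addrA.
Qed.

Lemma dominated_int F c M : cmeas (fun t => F (cvec t)) -> c < 1 ->
  (forall w, cabs (F w) <= M * expR (c * norm2 w)) ->
  cintble Ln (fun t => F (cvec t) * (gaussn 1 (cvec t))%:C) /\
  cabs (cint Ln (fun t => F (cvec t) * (gaussn 1 (cvec t))%:C)) <=
  2 * (M * \int[Ln]_t gaussn (1 - c) (cvec t)).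
Proof.
move=> mF c1 hM; have c10 : 0 < 1 - c by rewrite subr_gt0.
have mG : cmeas (fun t : n.-tuple RR => F (cvec t) * (gaussn 1 (cvec t))%:C).
  apply: cmeasM => //; apply: cmeas_real; apply: measurable_gaussn => k.
  exact: cmeas_cvec.
have bG (t : n.-tuple RR) : cabs (F (cvec t) * (gaussn 1 (cvec t))%:C) <= M * gaussn
  (1 - c) (cvec t).
  rewrite cabsM cabs_real ger0_norm ?gaussn_ge0//.
  have -> : gaussn (1 - c) (cvec t) = expR (c * norm2 (cvec t)) * gaussn 1 (cvec t).
    by rewrite /gaussn -expRD; congr expR; ring.
  by rewrite mulrA ler_wpM2r ?gaussn_ge0.
have iG := rintble_gaussn n c10.
split; first exact: (cintble_le mG bG (rintbleZ M iG)).
by rewrite (le_trans (le_cint mG bG (rintbleZ M iG)))// RintegralZl.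
Qed.

Lemma tame_int F : tame F -> cintble Ln (fun t => F (cvec t) * (gaussn 1 (cvec t))%:C).
Proof.
move=> [mF bF]; have [M hM] := bF 2^-1 (ltac:(by rewrite invr_gt0)).
have c1 : 2^-1 < 1 :> R by lra.
by have [] := dominated_int mF c1 hM.
Qed.

Lemma gauss_integralE F : cmeas (fun t => F (cvec t)) ->
  cintble Ln (fun t => F (cvec t) * (gaussn 1 (cvec t))%:C) ->
  gauss_integral F = (pi ^- n)%:C * cint Ln (fun t => F (cvec t) * (gaussn 1 (cvec
    t))%:C).
Proof.
move=> mF iF; rewrite -cintZ//.
have E : (fun w => F w * (gauss_density w)%:C) \o @cvec R n = fun t : n.-tuple RR =>
    (pi ^- n)%:C * (F (cvec t) * (gaussn 1 (cvec t))%:C).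
  apply/funext => t; rewrite /comp /gauss_density /gaussn mulN1r rmorphM/=; ring.
have iG := cintbleZ (pi ^- n)%:C iF.
rewrite -E in iG *.
have mG : cmeas (fun w => F w * (gauss_density w)%:C).
  apply: cmeas_cvecP; rewrite [X in cmeas X]E; apply: cmeasM; first exact: cmeas_cst.
  apply: cmeasM => //; apply: cmeas_real; apply: measurable_gaussn => k.
  exact: cmeas_cvec.
exact: (cint_push (m1 := Ln) (m2 := lebesgue_Cn R n) (@measurable_cvec R n) (fun _ _
  => erefl) mG iG).
Qed.

Lemma tame_integralE F : tame F ->
  gauss_integral F = (pi ^- n)%:C * cint Ln (fun t => F (cvec t) * (gaussn 1 (cvec
    t))%:C).
Proof. by move=> tF; apply: gauss_integralE; [exact: tF.1|exact: tame_int]. Qed.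

Lemma gauss_integralD F G : tame F -> tame G ->
  gauss_integral (fun w => F w + G w) = gauss_integral F + gauss_integral G.
Proof.
move=> tF tG; rewrite !tame_integralE//; last exact: tameD.
under eq_cint do rewrite mulrDl.
by rewrite cintD ?mulrDr//; exact: tame_int.
Qed.

Lemma gauss_integralZ k F : tame F ->
  gauss_integral (fun w => k * F w) = k * gauss_integral F.
Proof.
move=> tF; rewrite !tame_integralE//; last by apply: tameM => //; exact: tame_cst.
under eq_cint do rewrite -mulrA.
by rewrite cintZ 1?mulrCA//; exact: tame_int.
Qed.

Lemma gauss_integral_conj F : tame F ->
  gauss_integral (fun w => conjc (F w)) = conjc (gauss_integral F).
Proof.
move=> tF; rewrite !tame_integralE//; last exact: tame_conj.
rewrite [RHS]conjcM conjc_real -cint_conj; last exact: tame_int.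
by congr (_ * _); apply: eq_cint => t; rewrite [RHS]conjcM conjc_real.
Qed.

(** The constant [K] is uniform in [F], so that a bound with a small [M] makes the integral
    small. *)
Lemma le_gauss_integral c : c < 1 -> exists2 K, 0 <= K & forall F M, tame F ->
  (forall w, cabs (F w) <= M * expR (c * norm2 w)) -> cabs (gauss_integral F) <= K * M.
Proof.
move=> c1; exists (pi ^- n * 2 * \int[Ln]_t gaussn (1 - c) (cvec t)).
  rewrite !mulr_ge0 ?invr_ge0 ?exprn_ge0 ?pi_ge0//.
  by apply: Rintegral_ge0 => t _; exact: gaussn_ge0.
move=> F M tF hM; rewrite tame_integralE// cabsM cabs_real.
rewrite ger0_norm ?invr_ge0 ?exprn_ge0 ?pi_ge0//.
have [_ H] := dominated_int tF.1 c1 hM.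
rewrite (le_trans (ler_wpM2l _ H)) ?invr_ge0 ?exprn_ge0 ?pi_ge0//.
by rewrite le_eqVlt; apply/orP; left; apply/eqP; ring.
Qed.

Lemma reproducing F z : slow F ->
  gauss_integral (fun w => F w * cexp (cdot z (cconj w))) = F z.
Proof.
move=> [hF tF]; rewrite tame_integralE; last by apply: tameM => //; exact:
  tame_cexp_conj.
have [M hM] := tF.2 2^-1 (ltac:(by rewrite invr_gt0)).
have c1 : 0 <= (2^-1 : R) < 1 by apply/andP; split; lra.
rewrite (gauss_reproducing z hF tF.1 c1 hM) mulrA -rmorphM/=.
rewrite (_ : pi ^- n * pi ^+ n = 1) ?mul1r// mulVf// expf_neq0//.
by rewrite gt_eqF// pi_gt0.
Qed.

Lemma reproducing_kernel F a z : slow F ->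
  gauss_integral (fun w => F w * cexp (cdot w (cconj a)) * cexp (cdot z (cconj w))) =
  F z * cexp (cdot z (cconj a)).
Proof.
move=> sF; apply: (@reproducing (fun w => F w * cexp (cdot w (cconj a)))).
by apply: slowM => //; exact: slow_cexp.
Qed.

(** Conjugation exchanges the roles of z and a in [reproducing_kernel], which is why an
    antiholomorphic symbol gets evaluated at [a]. *)
Lemma reproducing_kernel_conj F a z : slow F ->
  gauss_integral (fun w => conjc (F w) * cexp (cdot w (cconj a)) * cexp (cdot z
    (cconj w))) =
  conjc (F a) * cexp (cdot z (cconj a)).
Proof.
move=> sF; have := congr1 conjc (reproducing_kernel z a sF).
rewrite -gauss_integral_conj; last first.
  apply: tameM; last exact: tame_cexp_conj.
  by apply: tameM; [exact: slow_tame|exact: tame_cexp].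
rewrite conjcM cexp_conj cdot_conj cconjK [cdot (cconj a) z]cdotC => <-.
congr gauss_integral; apply/funext => w.
by rewrite !conjcM !cexp_conj !cdot_conj !cconjK [cdot (cconj w) z]cdotC [cdot (cconj
  a) w]cdotC mulrAC.
Qed.

Lemma gauss_fubini (K : Cn -> Cn -> C) (A B : Cn -> C) c M : tame A -> tame B ->
  cmeas (fun q : n.-tuple RR * n.-tuple RR => K (cvec q.1) (cvec q.2)) -> c < 1 -> 0
    <= M ->
  (forall x w, cabs (K x w) <= M * (expR (c * norm2 x) * expR (c * norm2 w))) ->
  (forall x, gauss_integral (K x) = A x) ->
  (forall w, gauss_integral (K^~ w) = B w) ->
  gauss_integral A = gauss_integral B.
Proof.
move=> tA tB mK c1 M0 KM KA KB.
have c10 : 0 < 1 - c by rewrite subr_gt0.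
have mK1 x : cmeas (fun t : n.-tuple RR => K x (cvec t)).
  have := cmeas_comp mK (measurable_pair1 (uncvec x)); congr cmeas.
  by apply/funext => t; rewrite /= uncvecK.
have mK2 w : cmeas (fun t : n.-tuple RR => K (cvec t) w).
  have := cmeas_comp mK (measurable_pair2 (uncvec w)); congr cmeas.
  by apply/funext => t; rewrite /= uncvecK.
have b1 x w : cabs (K x w) <= M * expR (c * norm2 x) * expR (c * norm2 w).
  by rewrite -mulrA.
have b2 w x : cabs (K x w) <= M * expR (c * norm2 w) * expR (c * norm2 x).
  by rewrite -mulrA [expR _ * _]mulrC.
have i1 x := (dominated_int (mK1 x) c1 (b1 x)).1.
have i2 w := (@dominated_int (K^~ w) c _ (mK2 w) c1 (b2 w)).1.
have EA x := gauss_integralE (mK1 x) (i1 x).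
have EB w := @gauss_integralE (K^~ w) (mK2 w) (i2 w).
pose H (q : n.-tuple RR * n.-tuple RR) : C :=
  K (cvec q.1) (cvec q.2) * (gaussn 1 (cvec q.1))%:C * (gaussn 1 (cvec q.2))%:C.
have mH : cmeas H.
  apply: cmeasM; last apply: cmeas_real.
    apply: cmeasM => //; apply: cmeas_real; apply: measurable_gaussn => k.
    exact: (cmeas_comp (@cmeas_cvec R n k) measurable_fst).
  apply: measurable_gaussn => k.
  exact: (cmeas_comp (@cmeas_cvec R n k) measurable_snd).
have bH (s t : n.-tuple RR) : cabs (H (s, t)) <= M * gaussn (1 - c) (cvec s) * gaussn
  (1 - c) (cvec t).
  rewrite /H/= !cabsM !cabs_real !ger0_norm ?gaussn_ge0//.
  have E w : gaussn (1 - c) w = expR (c * norm2 w) * gaussn 1 w.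
    by rewrite /gaussn -expRD; congr expR; ring.
  rewrite !E (_ : M * _ * _ = M * expR (c * norm2 (cvec s)) * expR (c * norm2 (cvec
    t)) * gaussn 1 (cvec s) * gaussn 1 (cvec t)).
    by rewrite !ler_wpM2r ?gaussn_ge0.
  by ring.
have ig := rintble_gaussn n c10.
have ia := rintbleZ M ig.
have a0 (s : n.-tuple RR) : 0 <= M * gaussn (1 - c) (cvec s) by rewrite mulr_ge0
  ?gaussn_ge0.
have b0 (s : n.-tuple RR) : 0 <= gaussn (1 - c) (cvec s) by exact: gaussn_ge0.
have [F1 F2] := cint_fubini mH bH ia ig a0 b0.
have pin0 : (pi ^- n)%:C != 0 :> C.
  by rewrite -cabs_gt0 cabs_real normr_gt0 invr_neq0// expf_neq0// gt_eqF// pi_gt0.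
have HA (s : n.-tuple RR) : cint Ln (fun t => H (s, t)) =
    (pi ^- n)%:C^-1 * (A (cvec s) * (gaussn 1 (cvec s))%:C).
  rewrite -KA EA mulrA mulKf// mulrC -cintZ//.
  by apply: eq_cint => t; rewrite /H/=; ring.
have HB (t : n.-tuple RR) : cint Ln (fun s => H (s, t)) =
    (pi ^- n)%:C^-1 * (B (cvec t) * (gaussn 1 (cvec t))%:C).
  rewrite -KB EB mulrA mulKf// mulrC -cintZ//.
  by apply: eq_cint => s; rewrite /H/=; ring.
rewrite !tame_integralE//; congr (_ * _); apply: (mulfI (invr_neq0 pin0)).
rewrite -!cintZ; [|exact: tame_int|exact: tame_int].
transitivity (cint Ln (fun s => cint Ln (fun t => H (s, t)))).
  by apply: eq_cint => s; rewrite HA.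
apply: (etrans (esym F1)); apply: (etrans F2).
by apply: eq_cint => t; rewrite HB.
Qed.

End tame.

(** * Zero products *)
Section zero_product.
Context {R : realType} {n : nat}.
Local Notation C := R[i].
Local Notation Cn := 'rV[C]_n.
Implicit Types (F G f g u v : Cn -> C) (z w a b x : Cn).

Lemma slow_cst (k : C) : slow (fun _ : Cn => k).
Proof. by split; [move=> z d w; exact: cdiff_cst|exact: tame_cst]. Qed.

Lemma slowD F G : slow F -> slow G -> slow (fun w => F w + G w).
Proof.
move=> [hF tF] [hG tG]; split; last exact: tameD.
by move=> z d w; exact: cdiffD.
Qed.

Lemma gauss_integral_holo F : slow F -> gauss_integral F = F 0.
Proof.
move=> /(reproducing 0) <-; congr gauss_integral; apply/funext => w.
by rewrite /cdot big1 ?cexp0 ?mulr1// => k _; rewrite mxE mul0r.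
Qed.

Lemma gauss_integral_antiholo F : slow F -> gauss_integral (fun w => conjc (F w)) =
  conjc (F 0).
Proof. by move=> sF; rewrite gauss_integral_conj ?gauss_integral_holo//; exact:
  slow_tame. Qed.

Lemma tame_nonneg F c : tame F -> 0 < c -> exists2 M, 0 <= M &
  forall w, cabs (F w) <= M * expR (c * norm2 w).
Proof.
move=> [_ bF] /bF[M hM]; exists M => //.
by have := le_trans (cabs_ge0 _) (hM 0); rewrite pmulr_lge0// expR_gt0.
Qed.

(** Both sides come from the double integral of P(w) Q(x) e^(w . conj x). Integrating first in w
    reproduces conj g at b + x; integrating first in x reproduces [U] at w - z, where the factor
    e^(- l.(w - z)) cancels the l hidden in b = a + conj l, up to e^(z.l). *)
Lemma sesqui_shift u g z a (l : Cn) : slow u -> slow g ->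
  gauss_integral (fun w => conjc (g w) * u w * cexp (cdot w (cconj a)) * cexp (cdot z
    (cconj w))) =
  cexp (cdot z (cconj a)) *
  gauss_integral (fun x => u (z + x) * cexp (cdot x (- l)) * conjc (g (a + cconj l +
    x))).
Proof.
move=> su sg; set b := a + cconj l.
have bE : cconj b = cconj a + l by rewrite cconjD cconjK.
pose U x := u (z + x) * cexp (cdot x (- l)).
have sU : slow U by apply: slowM; [exact: slow_shift|exact: slow_cexp].
pose P w := conjc (g w) * cexp (cdot w (cconj b)) * cexp (cdot z (cconj w)).
have tP : tame P.
  apply: tameM; last exact: tame_cexp_conj.
  by apply: tameM; [apply: tame_conj; exact: slow_tame|exact: tame_cexp].
pose Q x := U x * cexp (cdot (- z) (cconj x)).
have tQ : tame Q by apply: tameM; [exact: slow_tame|exact: tame_cexp_conj].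
pose A x := cexp (cdot z (cconj b)) * (U x * conjc (g (b + x))).
have tUg : tame (fun x => U x * conjc (g (b + x))).
  apply: tameM; first exact: slow_tame.
  by apply: tame_conj; apply: tame_shift; exact: slow_tame.
pose J w := conjc (g w) * u w * cexp (cdot w (cconj a)) * cexp (cdot z (cconj w)).
have tJ : tame J.
  apply: tameM; last exact: tame_cexp_conj.
  apply: tameM; last exact: tame_cexp.
  by apply: tameM; [apply: tame_conj|]; exact: slow_tame.
pose B w := cexp (cdot z l) * J w.
have e4 : 0 < 4^-1 :> R by rewrite invr_gt0.
have [M1 M10 h1] := tame_nonneg tP e4; have [M2 M20 h2] := tame_nonneg tQ e4.
have AB : gauss_integral A = gauss_integral B.
  (* The kernel e^(w . conj x) costs the exponent 1/2 in each variable and the tame factors 1/4, so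
     3/4 < 1 in total. *)
  apply: (@gauss_fubini _ _ (fun x w => P w * (Q x * cexp (cdot w (cconj x)))) A B (3
    / 4) (M1 * M2)).
  - by apply: tameM => //; exact: tame_cst.
  - by apply: tameM => //; exact: tame_cst.
  - apply: cmeasM; first exact: (cmeas_comp tP.1 measurable_snd).
    apply: cmeasM; first exact: (cmeas_comp tQ.1 measurable_fst).
    apply: cmeas_cexp; apply: cmeas_cdot => [k|].
      exact: (cmeas_comp (@cmeas_cvec R n k) measurable_snd).
    apply: cmeas_cconj => k; exact: (cmeas_comp (@cmeas_cvec R n k) measurable_fst).
  - lra.
  - exact: mulr_ge0.
  - move=> x w; have e2 : 0 < 2^-1 :> R by rewrite invr_gt0.
    have := cabs_cexp_cdot w x e2; rewrite (_ : (4 * 2^-1)^-1 = 2^-1); last by field.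
    move=> h3; rewrite [cabs (P w * _)]cabsM [cabs (Q x * _)]cabsM.
    have E (y : R) : expR (3 / 4 * y) = expR (4^-1 * y) * expR (2^-1 * y).
      by rewrite -expRD; congr expR; field.
    rewrite !E (_ : M1 * M2 * _ = M1 * expR (4^-1 * norm2 w) *
      (M2 * expR (4^-1 * norm2 x) * (expR (2^-1 * norm2 w) * expR (2^-1 * norm2 x)))).
      apply: ler_pM; [exact: cabs_ge0|by rewrite mulr_ge0 ?cabs_ge0|exact: h1|].
      by apply: ler_pM; [exact: cabs_ge0|exact: cabs_ge0|exact: h2|exact: h3].
    by ring.
  - move=> x; pose k := U x * cexp (cdot (- z) (cconj x)).
    rewrite (_ : (fun w => _) = fun w => k * (conjc (g w) * cexp (cdot w (cconj (b +
      x))) *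
        cexp (cdot z (cconj w)))).
      rewrite gauss_integralZ ?reproducing_kernel_conj//; last first.
        apply: tameM; last exact: tame_cexp_conj.
        by apply: tameM; [apply: tame_conj; exact: slow_tame|exact: tame_cexp].
      rewrite /k /A cconjD cdotDr cexpD cdotNl cexpN.
      by field; exact: cexp_neq0.
    by apply/funext => w; rewrite /P /Q /k cconjD cdotDr cexpD; ring.
  - move=> w; pose k := P w.
    rewrite (_ : (fun x => _) = fun x => k * (U x * cexp (cdot (w - z) (cconj x)))).
      rewrite gauss_integralZ ?reproducing//; last first.
        by apply: tameM; [exact: slow_tame|exact: tame_cexp_conj].
      rewrite /k /P /U /B /J bE cdotDr cexpD [z + _]addrC subrK.
      rewrite [cdot (w - z) _]cdotNr cexpN cdotDl cdotNl cexpD cexpN.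
      by field; rewrite !cexp_neq0.
    by apply/funext => x; rewrite /k /Q [in RHS]cdotDl [cexp (cdot w _ + _)]cexpD; ring.
have l0 := cexp_neq0 (cdot z l).
apply: (mulfI l0); rewrite -(gauss_integralZ _ tJ) -/B -AB gauss_integralZ//.
by rewrite bE cdotDr cexpD; ring.
Qed.

Lemma toeplitz_kernel u v a z : slow u -> slow v ->
  toeplitz (fun w => u w + conjc (v w)) (fock_kernel a) z =
  (u z + conjc (v a)) * fock_kernel a z.
Proof.
move=> su sv; rewrite /toeplitz /fock_kernel.
rewrite (_ : (fun w => _) = fun w =>
  u w * cexp (cdot w (cconj a)) * cexp (cdot z (cconj w)) +
  conjc (v w) * cexp (cdot w (cconj a)) * cexp (cdot z (cconj w))); last first.
  by apply/funext => w; ring.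
rewrite gauss_integralD; first by rewrite reproducing_kernel//
  reproducing_kernel_conj// mulrDl.
- apply: tameM; last exact: tame_cexp_conj.
  by apply: tameM; [exact: slow_tame|exact: tame_cexp].
- apply: tameM; last exact: tame_cexp_conj.
  by apply: tameM; [apply: tame_conj; exact: slow_tame|exact: tame_cexp].
Qed.

(* [T_phi T_psi K_a (z) = 0] divided by [K_a z], for [phi = f + conj g] and
   [psi = u + conj v]; the value does not depend on the free parameter [l]. *)
Definition covariant_identity f g u v := forall z a (l : Cn),
  f z * u z + f z * conjc (v a) + conjc (g a) * conjc (v a) +
  gauss_integral (fun x => u (z + x) * cexp (cdot x (- l)) * conjc (g (a + cconj l +
    x))) = 0.

Lemma toeplitz_identity f g u v : slow f -> slow g -> slow u -> slow v ->
  toeplitz_prod_eq0 (fun z => f z + conjc (g z)) (fun z => u z + conjc (v z)) ->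
  covariant_identity f g u v.
Proof.
move=> sf sg su sv hT z a l.
have kK : kernel_span (fock_kernel a).
  exists 1%N, (fun=> 1), (fun=> a); apply/funext => w.
  by rewrite big_ord_recl big_ord0 addr0 mul1r.
have TE : toeplitz (fun z => u z + conjc (v z)) (fock_kernel a) =
    fun w => (u w + conjc (v a)) * fock_kernel a w.
  by apply/funext => w; exact: toeplitz_kernel.
have := hT _ kK z; rewrite TE.
rewrite /toeplitz /fock_kernel.
pose E w := cexp (cdot w (cconj a)); pose E' w := cexp (cdot z (cconj w)).
(* Of the four products only conj g times u is neither holomorphic nor antiholomorphic up to a
   constant; it is the one that leaves an integral behind. *)
rewrite (_ : (fun w => _) = fun w => (f w * u w) * E w * E' w +
  (conjc (v a) * (f w * E w * E' w) + (conjc (g w) * u w * E w * E' w +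
   conjc (v a) * (conjc (g w) * E w * E' w)))); last first.
  by apply/funext => w; rewrite /E /E'; ring.
have tEE F : tame F -> tame (fun w => F w * E w * E' w).
  move=> tF; apply: tameM; last exact: tame_cexp_conj.
  by apply: tameM => //; exact: tame_cexp.
have tf := slow_tame sf; have tu := slow_tame su.
have tg : tame (fun w => conjc (g w)) by apply: tame_conj; exact: slow_tame.
have t1 : tame (fun w => f w * u w * E w * E' w) by apply: tEE; exact: tameM.
have t2 : tame (fun w => f w * E w * E' w) by exact: tEE.
have t3 : tame (fun w => conjc (g w) * u w * E w * E' w) by apply: tEE; exact: tameM.
have t4 : tame (fun w => conjc (g w) * E w * E' w) by exact: tEE.
have tc F : tame F -> tame (fun w => conjc (v a) * F w).
  by move=> tF; apply: tameM => //; exact: tame_cst.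
rewrite gauss_integralD//; last first.
  by apply: tameD; [exact: tc|apply: tameD => //; exact: tc].
rewrite gauss_integralD//; [|exact: tc|by apply: tameD => //; exact: tc].
rewrite gauss_integralD//; last exact: tc.
rewrite !gauss_integralZ// (reproducing_kernel a z (slowM sf su)).
rewrite (reproducing_kernel a z sf) (reproducing_kernel_conj a z sg).
rewrite (sesqui_shift z a l su sg) => H.
apply: (mulfI (cexp_neq0 (cdot z (cconj a)))); rewrite mulr0 -[RHS]H.
by ring.
Qed.

(** This is [schwarz] on the line through 0 and w. For |s| <= r + 1 the exponent at s w is at most
    |w|^2/4, so a small c allows a large r and hence a small difference. *)
Lemma slow_near0 F M c r : slow F -> 1 < r -> c * (r + 1) ^+ 2 <= 4^-1 -> 0 <= c ->
  (forall w, cabs (F w) <= M * expR (c * norm2 w)) ->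
  forall w, cabs (F w - F 0) <= 2 * M / Num.sqrt (r - 1) * expR (4^-1 * norm2 w).
Proof.
move=> [hF _] r1 cr c0 FM w.
have M0 : 0 <= M.
  by have := le_trans (cabs_ge0 _) (FM 0); rewrite pmulr_lge0// expR_gt0.
pose h s := F (0 + s *: w).
have dh s : cdiff h s by exact: hF.
have hM s : cabs s <= r + 1 -> cabs (h s) <= M * expR (4^-1 * norm2 w).
  move=> sr; rewrite /h add0r (le_trans (FM _))// ler_wpM2l// ler_expR norm2Z mulrA.
  rewrite ler_wpM2r ?norm2_ge0// (le_trans _ cr)// ler_wpM2l//.
  by rewrite ler_sqr ?nnegrE ?cabs_ge0//; lra.
have := schwarz dh r1 hM; rewrite /h !add0r scale1r scale0r => H.
have r10 : 0 < r - 1 by lra.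
have s0 : 0 < Num.sqrt (r - 1) by rewrite sqrtr_gt0.
rewrite -ler_sqr ?nnegrE ?cabs_ge0 ?mulr_ge0 ?invr_ge0 ?expR_ge0 ?(ltW s0)//.
rewrite (le_trans H)// !exprMn exprVn sqr_sqrtr ?(ltW r10)//.
by rewrite le_eqVlt; apply/orP; left; apply/eqP; ring.
Qed.

Lemma large_radius (e c : R) : 0 < e -> exists2 r, 1 < r & c / Num.sqrt (r - 1) <= e.
Proof.
move=> e0; pose s := (`|c| + 1) / e.
have s0 : 0 < s by rewrite divr_gt0// ltr_wpDl.
exists (1 + s ^+ 2); first by rewrite ltrDl exprn_gt0.
rewrite addrC addKr sqrtr_sqr ger0_norm ?(ltW s0)// ler_pdivrMr//.
by rewrite /s mulrC divfK ?gt_eqF//; have := ler_norm c; lra.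
Qed.

(** The case c = 0 of [slow_near0], in which r is unrestricted. *)
Lemma liouville F M : slow F -> (forall w, cabs (F w) <= M) -> forall w, F w = F 0.
Proof.
move=> sF FM w; apply/eqP; rewrite -subr_eq0; apply/eqP; apply: cabs_arb => e e0.
have E0 : 0 < expR (4^-1 * norm2 w) by rewrite expR_gt0.
have [r r1 hr] := large_radius (2 * M) (divr_gt0 e0 E0).
have := @slow_near0 F M 0 r sF r1; rewrite mul0r => H.
apply: le_trans (H _ _ _ w) _; rewrite ?invr_ge0//.
  by move=> x; rewrite mul0r expR0 mulr1.
by rewrite -ler_pdivlMr.
Qed.

Lemma norm2D_exact z x : norm2 (z + x) =
  norm2 z + norm2 x + 2 * complex.Re (cdot x (cconj z)).
Proof.
rewrite !norm2E /cdot; have -> : complex.Re (\sum_(k < n) x 0 k * cconj z 0 k) =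
    \sum_(k < n) complex.Re (x 0 k * conjc (z 0 k)).
  by elim/big_rec2: _ => // k a b _ <-; rewrite ReD mxE.
rewrite mulr_sumr -!big_split/=; apply: eq_bigr => k _; rewrite mxE.
by rewrite !cabs_sqr; case: (z 0 k) (x 0 k) => [? ?] [? ?] /=; ring.
Qed.

(** A maximum up to the factor 2: such points exist as soon as the supremum is finite and positive,
    without asking whether it is attained. *)
Definition near_peak u c z := u z != 0 /\
  forall w, cabs (u w) * expR (- c * norm2 w) <= 2 * (cabs (u z) * expR (- c * norm2
    z)).

Lemma near_peak_ex u p c : slow u -> 0 < c -> u p != 0 -> exists2 z, near_peak u c z &
  cabs (u p) * expR (- c * norm2 p) <= 2 * (cabs (u z) * expR (- c * norm2 z)).
Proof.
move=> su c0 up; pose V w := cabs (u w) * expR (- c * norm2 w).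
have [M _ hM] := tame_nonneg (slow_tame su) c0.
have VM w : V w <= M.
  by rewrite /V mulNr expRN ler_pdivrMr ?expR_gt0.
have Vp : 0 < V p by rewrite mulr_gt0 ?expR_gt0// cabs_gt0.
have hs : has_sup (range V).
  by split; [exists (V p), p|exists M => _ [w _ <-]; exact: VM].
have ub w : V w <= sup (range V) by apply: ub_le_sup; [exact: hs.2|exists w].
have s0 : 0 < sup (range V) by exact: lt_le_trans (ub p).
have s20 : 0 < sup (range V) / 2 by rewrite divr_gt0.
have [_ [z _ <-] Vz] := sup_adherent s20 hs.
have key w : V w <= 2 * V z by have := ub w; lra.
exists z; last exact: (key p).
split; last exact: key.
apply: contraTneq Vz => uz0; have -> : V z = 0 by rewrite /V uz0 cabs0 mul0r.
by rewrite -leNgt; lra.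
Qed.

(* Since [u] has type zero, for small [c] a peak of [|u| e^(-c|.|^2)] is followed
   closely by the exponential [u z * e^(l . x)], [l] being the conjugate of [2 c z]. *)
Lemma peak_expansion u c r z : slow u -> near_peak u c z -> 0 <= c -> 1 < r ->
  c * (r + 1) ^+ 2 <= 4^-1 -> forall x,
  cabs (u (z + x) * cexp (cdot x (- ((2 * c)%:C *: cconj z))) / u z - 1) <=
  4 / Num.sqrt (r - 1) * expR (4^-1 * norm2 x).
Proof.
move=> su [uz peak] c0 r1 cr x; set l := _ *: _.
pose U x := u (z + x) * cexp (cdot x (- l)) * (u z)^-1.
have sU : slow U.
  apply: slowM; last exact: slow_cst.
  by apply: slowM; [exact: slow_shift|exact: slow_cexp].
have U0 : U 0 = 1.
  rewrite /U addr0 (_ : cdot 0 _ = 0) ?cexp0 ?mulr1 ?divff//.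
  by rewrite /cdot big1// => k _; rewrite mxE mul0r.
have uz0 : 0 < cabs (u z) by rewrite cabs_gt0.
have UM w : cabs (U w) <= 2 * expR (c * norm2 w).
  have := peak (z + w); rewrite norm2D_exact => H.
  rewrite /U !cabsM cabsV cabs_cexp ler_pdivrMr//.
  have -> : complex.Re (cdot w (- l)) = - (2 * c * complex.Re (cdot w (cconj z))).
    by rewrite cdotNr cdotC cdotZl cdotC -mulNr -rmorphN/= Re_real_mul mulNr.
  set y := complex.Re _ in H *.
  have E0 := expR_gt0 (c * (norm2 z + norm2 w)).
  rewrite -(ler_pM2r (expR_gt0 (- c * norm2 z))).
  have := ler_wpM2r (expR_ge0 (c * norm2 w)) H.
  rewrite -[cabs _ * _ * expR (c * _)]mulrA -expRD.
  rewrite -[cabs _ * _ * expR (- c * norm2 z)]mulrA -expRD.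
  have -> : - c * (norm2 z + norm2 w + 2 * y) + c * norm2 w = - (2 * c * y) + - c *
    norm2 z by ring.
  by move=> /le_trans; apply; rewrite le_eqVlt; apply/orP; left; apply/eqP; ring.
have := slow_near0 sU r1 cr c0 UM x; rewrite U0 => /le_trans; apply.
by rewrite ler_wpM2r ?expR_ge0// ler_wpM2r ?invr_ge0 ?sqrtr_ge0//; lra.
Qed.

(** The height [A] and the threshold [c0] depend on b and e but not on c and z, so that two points b
    can share a peak. The error [e1] comes from [v], and [e2] from [g v] and from the integral. *)
Lemma peak_limit f g u v b e : slow g -> slow u -> slow v -> covariant_identity f g u
  v ->
  0 < e -> exists2 A, 0 < A & exists2 c0, 0 < c0 & forall c z, 0 < c <= c0 ->
  near_peak u c z -> A * expR (c * norm2 z) <= cabs (u z) ->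
  exists e1 e2, [/\ cabs e1 <= e, cabs e2 <= e & f z * (1 + e1) + conjc (g b) + e2 = 0].
Proof.
move=> sg su sv id e0.
have e4 : 0 < 4^-1 :> R by rewrite invr_gt0.
have tg := tame_shift b (slow_tame sg); have tv := tame_shift b (slow_tame sv).
have [Mg Mg0 hg] := tame_nonneg tg e4; have [Mv Mv0 hv] := tame_nonneg tv e4.
have [Mgv Mgv0 hgv] := tame_nonneg (tameM tg tv) e4.
have [K K0 hK] := @le_gauss_integral R n (2^-1) (ltac:(lra)).
have e20 : 0 < e / 2 by rewrite divr_gt0.
have [r r1 hr] := large_radius (K * (4 * Mg)) e20.
pose A := (Mv + Mgv + 1) / (e / 2).
have A0 : 0 < A by rewrite divr_gt0// ltr_wpDl// addr_ge0.
have r10 : 0 < (r + 1) ^+ 2 by rewrite exprn_gt0//; lra.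
(* The bound c <= 1 gives |l|^2/4 = c^2 |z|^2 <= c |z|^2; the other one is the smallness asked by
   [peak_expansion]. *)
exists A => //; exists (Num.min 1 (4^-1 / (r + 1) ^+ 2)).
  by rewrite lt_min ltr01 divr_gt0.
move=> c z /andP[c0]; rewrite le_min => /andP[c1]; rewrite ler_pdivlMr// => cr peak Au.
have uz : 0 < cabs (u z) by rewrite cabs_gt0; case: peak.
pose l := (2 * c)%:C *: cconj z.
have lE : cconj l = (2 * c)%:C *: z.
  by apply/rowP => k; rewrite !mxE conjcM conjc_real conjcK.
pose y := - cconj l.
have yN : 4^-1 * norm2 y <= c * norm2 z.
  rewrite /y -scaleN1r norm2Z cabsN cabs1 expr1n mul1r lE norm2Z cabs_real.
  rewrite ger0_norm ?mulr_ge0 ?(ltW c0)// mulrA ler_wpM2r ?norm2_ge0//.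
  rewrite (_ : 4^-1 * (2 * c) ^+ 2 = c * c); last by field.
  by rewrite ler_piMr// ltW.
have bnd M F : 0 <= M -> M <= Mv + Mgv + 1 -> cabs (F y) <= M * expR (4^-1 * norm2 y) ->
    cabs (F y / u z) <= e / 2.
  move=> M0 MA HF; rewrite cabsM cabsV ler_pdivrMr// (le_trans HF)//.
  rewrite (le_trans _ (ler_wpM2l (ltW e20) Au))//.
  have -> : e / 2 * (A * expR (c * norm2 z)) = (Mv + Mgv + 1) * expR (c * norm2 z).
    by rewrite /A; field; exact: lt0r_neq0.
  by rewrite ler_pM ?expR_ge0 ?ler_expR.
have b1 : cabs (v (b + y) / u z) <= e / 2.
  by apply: (bnd Mv (fun y => v (b + y))) => //; lra.
have b2 : cabs (g (b + y) * v (b + y) / u z) <= e / 2.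
  by apply: (bnd Mgv (fun y => g (b + y) * v (b + y))) => //; lra.
pose U x := u (z + x) * cexp (cdot x (- l)) / u z.
have tU : tame U.
  apply: tameM; last exact: tame_cst.
  apply: tameM; last exact: tame_cexp.
  by apply: tame_shift; exact: slow_tame.
have tgc := tame_conj tg.
have tU1 : tame (fun x => (U x - 1) * conjc (g (b + x))).
  by apply: tameM => //; apply: tameD => //; exact: tame_cst.
pose d := gauss_integral (fun x => (U x - 1) * conjc (g (b + x))).
have dE : cabs d <= e / 2.
  rewrite (le_trans _ hr)//.
  have := hK _ (4 / Num.sqrt (r - 1) * Mg) tU1 _; rewrite -/d => H.
  apply: le_trans (H _) _; last by rewrite le_eqVlt; apply/orP; left; apply/eqP; ring.
  move=> x; rewrite cabsM cabs_conj.
  have -> : 2^-1 * norm2 x = 4^-1 * norm2 x + 4^-1 * norm2 x by field.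
  rewrite expRD mulrACA; apply: ler_pM; rewrite ?cabs_ge0//.
  exact: (peak_expansion su peak (ltW c0) r1 cr).
(* With a = b - conj l, the argument of [g] under the integral becomes b + x. There the quotient [U]
   is replaced by 1 at the cost of [d], and conj g integrates to its value at b. *)
have := id z (b + y) l; rewrite -[b + y + _]addrA /y addNr addr0 -/y.
rewrite (_ : (fun x => _) = fun x => u z * ((U x - 1) * conjc (g (b + x)) + conjc (g
  (b + x)))); last first.
  by apply/funext => x; rewrite /U; field; rewrite -cabs_gt0.
rewrite gauss_integralZ; last exact: tameD.
rewrite gauss_integralD// -/d (gauss_integral_antiholo (slow_shift b sg)) addr0 => H.
have uz' : u z != 0 by rewrite -cabs_gt0.
exists (conjc (v (b + y)) / u z), (conjc (g (b + y)) * conjc (v (b + y)) / u z + d);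
  split.
- by rewrite cabsM cabs_conj -cabsM (le_trans b1)//; lra.
- rewrite (le_trans (cabsD _ _))// [e]splitr lerD//.
  by rewrite -conjcM cabsM cabs_conj -cabsM.
- by apply: (mulfI uz'); rewrite mulr0 -[RHS]H; field.
Qed.

Lemma antiholo_part_cst f g u v : slow g -> slow u -> slow v -> covariant_identity f
  g u v ->
  (exists p, u p != u 0) -> forall b b', g b = g b'.
Proof.
move=> sg su sv id [p0 up0] b b'.
apply/eqP; rewrite -subr_eq0 -cabs_eq0 -cabs_conj; apply/eqP.
have D0 : 0 < 4 + cabs (g b) + cabs (g b').
  by rewrite !ltr_wpDr ?cabs_ge0.
suff key e : 0 < e <= 1 -> cabs (conjc (g b - g b')) <= e * (4 + cabs (g b) + cabs (g
  b')).
  apply/eqP; rewrite cabs_eq0; apply/eqP; apply: cabs_arb => e e0.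
  pose e' := Num.min 1 (e / (4 + cabs (g b) + cabs (g b'))).
  have e'0 : 0 < e' by rewrite lt_min ltr01 divr_gt0.
  have e'1 : 0 < e' <= 1 by rewrite e'0 /e' ge_min lexx.
  by rewrite (le_trans (key _ e'1))// -ler_pdivlMr// /e' ge_min lexx orbT.
move=> /andP[e0 e1].
have [A A0 [c0 c00 H]] := peak_limit b sg su sv id e0.
have [A' A'0 [c0' c00' H']] := peak_limit b' sg su sv id e0.
pose B := Num.max A A'.
have B0 : 0 < B by rewrite lt_max A0.
(* The factor 4 pays for the factor 2 in the comparison of p with the peak and for e^(-c |p|^2) >=
   1/2, which the choice of c below ensures. *)
have [p up] : exists p, 4 * B <= cabs (u p).
  apply: contrapT => nB; move/eqP: up0; apply.
  apply: (@liouville u (4 * B)) => // w.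
  by rewrite leNgt; apply/negP => lt; apply: nB; exists w; exact: ltW.
have p1 : 0 < norm2 p + 1 by rewrite ltr_wpDl// norm2_ge0.
pose c := Num.min (Num.min c0 c0') (2 * (norm2 p + 1))^-1.
have cgt : 0 < c by rewrite !lt_min c00 c00' invr_gt0 mulr_gt0.
have cl : c <= c0 by rewrite !ge_min lexx.
have cl' : c <= c0' by rewrite !ge_min lexx !orbT.
have cp : c * norm2 p <= 2^-1.
  rewrite (@le_trans _ _ ((2 * (norm2 p + 1))^-1 * norm2 p))//.
    by rewrite ler_wpM2r ?norm2_ge0// ge_min lexx orbT.
  by rewrite mulrC ler_pdivrMr ?mulr_gt0// mulKf// lerDl.
have upn : u p != 0 by rewrite -cabs_gt0; apply: lt_le_trans up; rewrite mulr_gt0.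
have [z peak up2] := near_peak_ex su cgt upn.
have Bz : B * expR (c * norm2 z) <= cabs (u z).
  rewrite -ler_pdivlMr ?expR_gt0// -expRN -mulNr.
  have : 4 * B * expR (- c * norm2 p) <= 2 * (cabs (u z) * expR (- c * norm2 z)).
    by rewrite (le_trans _ up2)// ler_wpM2r ?expR_ge0.
  have : B * 2^-1 <= B * expR (- c * norm2 p).
    rewrite ler_wpM2l ?(ltW B0)// (le_trans _ (expR_ge1Dx _))// mulNr; lra.
  by lra.
have Az : A * expR (c * norm2 z) <= cabs (u z).
  by rewrite (le_trans _ Bz)// ler_wpM2r ?expR_ge0// le_max lexx.
have Az' : A' * expR (c * norm2 z) <= cabs (u z).
  by rewrite (le_trans _ Bz)// ler_wpM2r ?expR_ge0// le_max lexx orbT.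
have cc : 0 < c <= c0 by rewrite cgt. have cc' : 0 < c <= c0' by rewrite cgt.
have [s1 [s2 [s1e s2e E]]] := H _ _ cc peak Az.
have [t1 [t2 [t1e t2e E']]] := H' _ _ cc' peak Az'.
(* Cross-multiplying the two relations eliminates the unknown value [f z]. *)
have key : conjc (g b - g b') = t2 - s2 + s1 * (conjc (g b') + t2) - t1 * (conjc (g
  b) + s2).
  have -> : conjc (g b - g b') = conjc (g b) - conjc (g b') by rewrite rmorphB.
  have F1 : conjc (g b) + s2 = - (f z * (1 + s1)) by apply/eqP; rewrite -addr_eq0
    -[eqbRHS]E; apply/eqP; ring.
  have F2 : conjc (g b') + t2 = - (f z * (1 + t1)) by apply/eqP; rewrite -addr_eq0
    -[eqbRHS]E'; apply/eqP; ring.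
  have G1 : conjc (g b) = - (f z * (1 + s1)) - s2 by rewrite -F1; ring.
  have G2 : conjc (g b') = - (f z * (1 + t1)) - t2 by rewrite -F2; ring.
  by rewrite G1 G2; ring.
rewrite key (le_trans (cabsB _ _))//.
have I1 := cabsD (t2 - s2) (s1 * (conjc (g b') + t2)); have I2 := cabsB t2 s2.
have I3 := cabsD (conjc (g b')) t2; have I4 := cabsD (conjc (g b)) s2.
rewrite !cabs_conj in I3 I4; rewrite !cabsM in I1 *.
have J1 : cabs s1 * cabs (conjc (g b') + t2) <= e * (cabs (g b') + 1).
  by apply: ler_pM; rewrite ?cabs_ge0//; lra.
have J2 : cabs t1 * cabs (conjc (g b) + s2) <= e * (cabs (g b) + 1).
  by apply: ler_pM; rewrite ?cabs_ge0//; lra.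
have -> : e * (4 + cabs (g b) + cabs (g b')) = e + e + e * (cabs (g b') + 1) + e *
  (cabs (g b) + 1) by ring.
by lra.
Qed.

(** If F(p) is nonzero, then by continuity [G] vanishes near p on the complex line from p to q, and
    the identity theorem on this line gives G(q) = 0. *)
Lemma slow_integral_domain F G : slow F -> slow G -> (forall z, F z * G z = 0) ->
  (forall z, F z = 0) \/ (forall z, G z = 0).
Proof.
move=> [hF _] sG FG; have [?|/existsNP[p /eqP Fp]] := pselect (forall z, F z = 0);
  first by left.
right=> q; pose d := q - p; have Fp0 : 0 < cabs (F p) by rewrite cabs_gt0.
have [r r0 hr] := cdiff_cont (hF p d 0) (ltac:(exact: (divr_gt0 Fp0 (ltr0Sn _ 1)))).
have G0 (w : C) : cabs w < r -> G (p + w *: d) = 0.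
  move=> /hr; rewrite !add0r scale0r addr0 => H.
  have := FG (p + w *: d) => /eqP; rewrite mulf_eq0 => /orP[/eqP F0|/eqP//].
  by exfalso; move: H; rewrite F0 sub0r cabsN; lra.
have [M M0 hM] := tame_nonneg (tame_shift p (slow_tame sG)) ltr01.
(* The point q has parameter 1, so a bound is required for |w| <= 4, where |w|^2 <= 16. *)
have := @identity_theorem R (fun w : C => G (p + w *: d)) r 1 (M * expR (16 * norm2 d))
  (sG.1 p d) r0 G0.
rewrite scale1r (_ : p + d = q); last by rewrite /d addrC subrK.
apply => w; rewrite cabs1 mulr1 => w4.
rewrite (le_trans (hM _))// ler_wpM2l// ler_expR mul1r norm2Z ler_wpM2r ?norm2_ge0//.
have := cabs_ge0 w; nra.
Qed.

Lemma zero_product f g u v : slow f -> slow g -> slow u -> slow v ->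
  covariant_identity f g u v ->
  (forall z, f z + conjc (g z) = 0) \/ (forall z, u z + conjc (v z) = 0).
Proof.
move=> sf sg su sv id.
have [uc|/existsNP[p /eqP up]] := pselect (forall p, u p = u 0).
  have H z a : (f z + conjc (g a)) * (u 0 + conjc (v a)) = 0.
    rewrite -[RHS](id z a 0) (_ : (fun x => _) = fun x => u 0 * conjc (g (a + x))).
      rewrite gauss_integralZ; last by apply: tame_conj; apply: tame_shift; exact:
        slow_tame.
      by rewrite (gauss_integral_antiholo (slow_shift a sg)) addr0 uc; ring.
    apply/funext => x; rewrite uc (_ : cconj 0 = 0 :> Cn); last by apply/rowP => k;
      rewrite !mxE conjc0.
    by rewrite addr0 oppr0 (_ : cdot x 0 = 0) ?cexp0 ?mulr1// /cdot big1// => k _;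
      rewrite mxE mulr0.
  have [v0|/existsNP[a0 /eqP va0]] := pselect (forall a, u 0 + conjc (v a) = 0).
    by right=> z; rewrite uc.
  have fE z : f z = - conjc (g a0).
    by apply/eqP; rewrite -addr_eq0; have /eqP := H z a0; rewrite mulf_eq0 (negbTE
      va0) orbF.
  (* As z and a are independent in [H], [f] is now constant; the conjugate of [H] is a product of
     two holomorphic functions of a. *)
  have sg' : slow (fun a => g a + - g a0) by apply: slowD => //; exact: slow_cst.
  have sv' : slow (fun a => v a + conjc (u 0)) by apply: slowD => //; exact: slow_cst.
  have [|G0|G0] := slow_integral_domain sg' sv'.
  - move=> a; apply: (can_inj (@conjcK R)); rewrite conjcM !conjcD conjcK conjc0
    -[RHS](H a a) fE.
    by rewrite rmorphN; ring.
  - left=> z; rewrite fE -[RHS]conjc0 -(G0 z) conjcD rmorphN; ring.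
  - exfalso; move/eqP: va0; apply; rewrite -[RHS]conjc0 -(G0 a0) conjcD conjcK; ring.
have gc := antiholo_part_cst sg su sv id (ex_intro _ p up).
have H z : (f z + conjc (g 0)) * (u z + conjc (v 0)) = 0.
  rewrite -[RHS](id z 0 0) (_ : (fun x => _) = fun x => conjc (g 0) * u (z + x)).
    rewrite gauss_integralZ; last by apply: tame_shift; exact: slow_tame.
    by rewrite (gauss_integral_holo (slow_shift z su)) addr0; ring.
  apply/funext => x; rewrite (gc _ 0) oppr0 (_ : cdot x 0 = 0) ?cexp0 ?mulr1 1?mulrC//.
  by rewrite /cdot big1// => k _; rewrite mxE mulr0.
have sF : slow (fun z => f z + conjc (g 0)) by apply: slowD => //; exact: slow_cst.
have sG : slow (fun z => u z + conjc (v 0)) by apply: slowD => //; exact: slow_cst.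
have [F0|G0] := slow_integral_domain sF sG H; first by left=> z; rewrite (gc z 0).
by move/eqP: up; case; apply: (addIr (conjc (v 0))); rewrite !G0.
Qed.

End zero_product.

(** * Entire functions of the class Sym *)
Section symbols.
Context {R : realType} {n : nat}.
Local Notation C := R[i].
Local Notation Cn := 'rV[C]_n.
Local Notation RR := (measurableTypeR R * measurableTypeR R)%type.
Local Notation leb := (@lebesgue_measure R).
Local Notation leb2 := (sigma_finite_prod leb leb).
Local Notation Ln n := (tuple_measure leb2 n).

Lemma entire_line_holo (f : Cn -> C) : entire f -> line_holo f.
Proof.
move=> df z d w; set x := z + w *: d.
(* The norm on C^n has values in [R[i]], so the radii given by the topology are positive complex
   numbers, to be turned into real ones. *)
have real (r : C) : 0 < r -> exists2 k, 0 < k & r = k%:C.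
  move=> r0; have /complex_realP[k kE] : r \is Num.real by exact: gtr0_real.
  by exists k => //; rewrite -ltcR -kE.
apply: cdiff_expand; exists ('d (f : Cn -> C^o) x d) => e e0.
have [k k0 kE] := real (`|d| + 1) (ltr_wpDl (normr_ge0 d) ltr01).
have ek : 0 < (e / k)%:C :> C by rewrite ltcR divr_gt0.
have /eqaddoP /(_ _ ek) /nbhs_norm0P [r0 /= /real[r rgt ->] hr] := diff_locally (df x).
exists (r / k); first by rewrite divr_gt0.
have dk (s : C) : `|s *: d| <= (cabs s * k)%:C.
  by rewrite normrZ normCE rmorphM/= -kE ler_wpM2l ?ler0c ?cabs_ge0// lerDl.
move=> s; rewrite ltr_pdivlMr// => sr.
have := hr (s *: d) (le_lt_trans (dk s) _).
rewrite ltcR => /(_ sr).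
rewrite !fctE /= linearZ/= (addrC (s *: d)) [(w + s) *: d]scalerDl addrA -/x.
rewrite normCE => /le_trans /(_ (ler_wpM2l (ltW ek) (dk s))).
rewrite -rmorphM/= lecR opprD addrA.
set D := 'd _ _ _; have -> : s *: D = D * s by exact: mulrC.
move=> H.
by rewrite (le_trans H)// le_eqVlt; apply/orP; left; apply/eqP; field; exact: lt0r_neq0.
Qed.

Lemma box_gt0 m (B : 'I_m -> set RR) : (forall i, measurable (B i)) ->
  (forall i, 0 < leb2 (B i))%E ->
  measurable [set t : m.-tuple RR | forall i, B i (tnth t i)] /\
  (0 < Ln m [set t : m.-tuple RR | forall i, B i (tnth t i)])%E.
Proof.
elim: m B => [|m IH] B mB B0.
  rewrite (_ : [set t : 0.-tuple RR | _] = setT).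
    by split => //=; rewrite diracT lte_fin.
  by apply/seteqP; split => // t _ [].
have [mS S0] := IH (fun i => B (lift ord0 i)) (fun i => mB _) (fun i => B0 _).
set S := [set t : m.-tuple RR | _] in mS S0.
have E : [set t : m.+1.-tuple RR | forall i, B i (tnth t i)] =
    @uncons_pt _ _ m @^-1` (B ord0 `*` S).
  apply/seteqP; split => t /=.
    move=> H; split; first exact: H.
    by move=> i; have := H (lift ord0 i); rewrite [t in tnth t (lift _ _)]tuple_eta
      tnthS.
  move=> [h0 hS] i; case: (unliftP ord0 i) => [j ->|->//].
  by rewrite [t in tnth t _]tuple_eta tnthS; exact: hS.
rewrite E; split.
  by rewrite -[X in measurable X]setTI; apply: measurable_uncons_pt => //; exact:
    measurableX.
rewrite /= /cons_measure /pushforward -comp_preimage.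
rewrite (_ : _ \o _ = id); last by apply/funext => p; exact: cons_ptK.
rewrite preimage_id /sigma_finite_prod product_measure1E//.
exact: (mule_gt0 (B0 ord0) S0).
Qed.

Lemma square_gt0 (a b d : R) : 0 < d ->
  let S : set RR := `]a - d, a + d[%classic `*` `]b - d, b + d[%classic in
  measurable S /\ (0 < leb2 S)%E.
Proof.
move=> d0; have I (c : R) : (0 < leb (`]c - d, c + d[%classic)%R)%E.
  rewrite lebesgue_measure_itv/= lte_fin (_ : (c - d < c + d) = true).
    by rewrite -EFinB lte_fin; lra.
  by apply/idP; lra.
split; first exact: measurableX.
rewrite /S /sigma_finite_prod product_measure1E//.
exact: (mule_gt0 (I a) (I b)).
Qed.

(** An open box around z has positive measure and so is not contained in a null set. *)
Lemma ae_dense (P : Cn -> Prop) : {ae lebesgue_Cn R n, forall z, P z} ->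
  forall (z : Cn) (d : R), 0 < d -> exists2 w, P w & forall k, cabs (w 0 k - z 0 k)
    <= 2 * d.
Proof.
move=> [A [mA A0 PA]] z d d0; apply: contrapT => H.
have [mS] := box_gt0 (fun i => (square_gt0 (complex.Re (z 0 i)) (complex.Im (z 0 i))
  d0).1)
  (fun i => (square_gt0 (complex.Re (z 0 i)) (complex.Im (z 0 i)) d0).2).
set S := [set t : n.-tuple RR | _] in mS *.
rewrite ltNge => /negP; apply.
have SA : S `<=` @cvec R n @^-1` A.
  move=> t St; apply: PA => /= Pt; apply: H; exists (cvec t) => // k.
  rewrite mxE; have [/=] := St k; rewrite !in_itv/= -!ltr_distlC => h1 h2.
  have E (x y : R) (c : C) : `|complex.Re c - x| < d -> `|complex.Im c - y| < d ->
      cabs (x +i* y - c) <= 2 * d.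
    case: c => a b /=; rewrite distrC [`|b - y|]distrC => xa yb.
    by apply: le_trans (cabs_le_ReIm _) _ => /=; lra.
  exact: E.
have mA' : measurable (@cvec R n @^-1` A) by [].
rewrite -A0 lebesgue_CnE; apply: le_measure => //; by rewrite inE.
Qed.

(** Continuity and density turn the essential bound into one at every point. Starting from c/2
    leaves room to pass from a nearby w to z, since c/2 |w|^2 <= c + c |z|^2 when |w - z| <= 1. *)
Lemma entire_Sym_slow (u : Cn -> C) : Sym u -> entire u -> slow u.
Proof.
move=> [mu bu] hu; split; first exact: entire_line_holo.
split; first exact: (cmeas_comp mu (@measurable_cvec R n)).
move=> c c0; have c20 : 0 < c / 2 by rewrite divr_gt0.
have [M hM] := bu _ c20.
have gM w : `|u w * (expR (- (c / 2) * norm2 w))%:C| <= M%:C -> cabs (u w) <= M *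
  expR (c / 2 * norm2 w).
  rewrite normCE lecR cabsM cabs_real ger0_norm ?expR_ge0// mulNr expRN.
  by rewrite ler_pdivrMr ?expR_gt0.
exists (`|M| * expR c) => z; apply/ler_addgt0Pr => e e0.
have ce : 0 < e%:C :> C by rewrite ltcR.
have /cvgrPdist_lt /(_ _ ce) /nbhs_ballP [r0 /= r0gt hr] :=
  differentiable_continuous (hu z : differentiable (u : Cn -> C^o) z).
have /complex_realP[r rE] : r0 \is Num.real by exact: gtr0_real.
have rgt : 0 < r by rewrite -ltcR -rE.
(* The first bound stays within the radius of continuity. The second makes every coordinate of w - z
   at most 1/(n + 1), whence |w - z| <= 1. *)
pose d := Num.min (r / 4) (2 * n.+1%:R)^-1.
have d0 : 0 < d by rewrite lt_min divr_gt0//= invr_gt0 mulr_gt0.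
have dr : 2 * d < r by apply: (@le_lt_trans _ _ (2 * (r / 4))); [rewrite ler_wpM2l//
  ge_min lexx|lra].
have [w /gM wM wz] := ae_dense hM z d0.
have uw : cabs (u z - u w) < e.
  rewrite -ltcR -normCE; apply: hr; split => // i j; rewrite (ord1 i) -ball_normE /=
    distrC normCE rE ltcR.
  exact: le_lt_trans (wz j) dr.
have N1 : norm2 (w - z) <= 1.
  have d1 : 2 * d <= n.+1%:R^-1.
    apply: (@le_trans _ _ (2 * (2 * n.+1%:R)^-1)); first by rewrite ler_wpM2l//
      ge_min lexx orbT.
    by rewrite invfM mulrA divff// mul1r.
  have n1 : n.+1%:R^-1 <= 1 :> R by rewrite invf_le1// ler1n.
  rewrite norm2E; apply: (@le_trans _ _ (\sum_(k < n) n.+1%:R^-1)).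
    apply: ler_sum => k _; rewrite !mxE.
    apply: (@le_trans _ _ (n.+1%:R^-1 ^+ 2)).
      rewrite ler_sqr ?nnegrE ?cabs_ge0 ?invr_ge0//.
      exact: le_trans (wz k) d1.
    by rewrite expr2 ler_piMr ?invr_ge0.
  rewrite sumr_const card_ord -[_ *+ n]mulr_natr mulrC ler_pdivrMr// mul1r ler_nat.
  exact: leqnSn.
have Nw : c / 2 * norm2 w <= c + c * norm2 z.
  have := norm2D z (w - z); rewrite addrC subrK => H.
  have := ler_wpM2l (ltW c20) (le_trans H (lerD (lexx _) (ler_wpM2l (ler0n _ 2) N1))).
  by lra.
have := cabsD (u z - u w) (u w); rewrite subrK.
have : M * expR (c / 2 * norm2 w) <= `|M| * expR c * expR (c * norm2 z).
  rewrite -[leRHS]mulrA -expRD (le_trans (ler_wpM2r (expR_ge0 _) (ler_norm M)))//.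
  by rewrite ler_wpM2l// ler_expR.
by move: wM uw; lra.
Qed.

End symbols.

Theorem corollary3 (R : realType) (n : nat) (hn : (1 <= n)%N)
  (f g u v phi psi : 'rV[R[i]]_n -> R[i])
  (fS : Sym f) (fH : entire f) (gS : Sym g) (gH : entire g)
  (uS : Sym u) (uH : entire u) (vS : Sym v) (vH : entire v)
  (hphi : phi = fun z => f z + conjc (g z))
  (hpsi : psi = fun z => u z + conjc (v z))
  (hT : toeplitz_prod_eq0 phi psi) :
  phi = (fun=> 0) \/ psi = (fun=> 0).
Proof.
have [fL gL uL vL] : [/\ slow f, slow g, slow u & slow v].
  by split; exact: entire_Sym_slow.
rewrite {}hphi {}hpsi in hT *.
have [H|H] := zero_product fL gL uL vL (toeplitz_identity fL gL uL vL hT).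
  by left; apply/funext.
by right; apply/funext.
Qed.
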